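(* Let $M$ be a smooth manifold of dimension $2h+2\geq 4$. There is a bijection between the following two kinds of structures: (1) contact pairs $(\alpha,\beta)$ of type $(h,0)$, and (2) locally conformally symplectic forms $\omega$ with Lee form $\theta$ admitting a vector field $X$ satisfying $L_X\omega=0$ and $\theta(X)=1$. Under this bijection the Reeb vector fields $A$ and $B$ of $(\alpha,\beta)$ correspond to $L$ and $X$ respectively. Moreover, $\omega^{h+1}$ and $\alpha\wedge(d\alpha)^h\wedge\beta$ define the same orientation on $M$.
   Context: A contact pair of type $(h,0)$ on a $(2h+2)$-dimensional manifold $M$ is a pair $(\alpha,\beta)$ of one-forms such that $\alpha\wedge(d\alpha)^h\wedge\beta$ is a volume form, $(d\alpha)^{h+1}=0$ and $d\beta=0$. Its Reeb vector fields $A,B$ are the unique vector fields with $\alpha(A)=\beta(B)=1$, $\alpha(B)=\beta(A)=0$ and $i_Ad\alpha=i_Ad\beta=i_Bd\alpha=i_Bd\beta=0$. A locally conformally symplectic (lcs) form on $M$ is a non-degenerate two-form $\omega$ which can be rescaled locally, near any point, so as to be symplectic; equivalently, $d\omega=\omega\wedge\theta$ for some closed one-form $\theta$, called the Lee form of $\omega$. For an lcs form $\omega$ with Lee form $\theta$, $L$ denotes the unique vector field on $M$ defined by $i_L\omega=\theta$. For a vector field $X$, $L_X$ denotes the Lie derivative and $i_X$ the interior product. *)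

(* Defs.v *)
From HB Require Import structures.
From mathcomp Require Import all_boot all_order all_algebra all_fingroup.
From mathcomp Require Import all_classical all_reals all_analysis.
Set Implicit Arguments.
Unset Strict Implicit.
Unset Printing Implicit Defensive.
Import Order.TTheory GRing.Theory Num.Theory.
Import numFieldNormedType.Exports.
Local Open Scope classical_set_scope.
Local Open Scope ring_scope.

(* All partial derivatives of order < k exist on U and are (Frechet)
   differentiable there, those of order k are continuous.  For U open and all
   k this is the usual C^oo condition.                                        *)
Fixpoint Ck_on (R : realType) (n k : nat) (U : set 'rV[R]_n)
    (f : 'rV[R]_n -> R) : Prop :=
  if k is k'.+1 then
    (forall x, U x -> differentiable f x) /\
    (forall i : 'I_n, Ck_on k' U (fun x => 'D_(delta_mx 0 i) f x))
  else forall x, U x -> {for x, continuous f}.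

Definition smooth_on (R : realType) (n : nat) (U : set 'rV[R]_n)
    (f : 'rV[R]_n -> R) : Prop := forall k, Ck_on k U f.

Definition smooth_map_on (R : realType) (n m : nat) (U : set 'rV[R]_n)
    (f : 'rV[R]_n -> 'rV[R]_m) : Prop :=
  forall j, smooth_on U (fun x => f x 0 j).

(* [cto] and [cinv] are total functions; only their values on [cdom] and on
   the image [cto @` cdom] matter.                                            *)
Record chart (R : realType) (n : nat) (M : topologicalType) := Chart {
  cdom : set M;
  cto : M -> 'rV[R]_n;
  cinv : 'rV[R]_n -> M;
  cdom_open : open cdom;
  cimg_open : open (cto @` cdom);
  ctoK : forall p, cdom p -> cinv (cto p) = p;
  cto_continuous : forall p, cdom p -> {for p, continuous cto};
  cinv_continuous : forall x, (cto @` cdom) x -> {for x, continuous cinv} }.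

Definition cimg (R : realType) (n : nat) (M : topologicalType)
  (c : chart R n M) : set 'rV[R]_n := cto c @` cdom c.

(* An atlas, together with the choice of a preferred chart around every point.
   The tangent space at p is 'rV[R]_n, its elements being the coordinates of
   tangent vectors in the preferred chart at p.                               *)
Record smoothManifold (R : realType) (n : nat) := SmoothManifold {
  carrier :> topologicalType;
  manifold_hausdorff : hausdorff_space carrier;
  manifold_second_countable : @second_countable carrier;
  atlas : set (chart R n carrier);
  chart_at : carrier -> chart R n carrier;
  chart_at_atlas : forall p, atlas (chart_at p);
  chart_at_dom : forall p, cdom (chart_at p) p;
  transition_smooth : forall c c', atlas c -> atlas c' ->
    smooth_map_on (cto c @` (cdom c `&` cdom c')) (cto c' \o cinv c) }.

Definition vfield (R : realType) (n : nat) (M : smoothManifold R n) : Type :=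
  M -> 'rV[R]_n.

(* k tangent vectors at a point form the rows of a k x n matrix.              *)
Definition kform (R : realType) (n : nat) (M : smoothManifold R n) (k : nat) :
  Type := M -> 'M[R]_(k, n) -> R.

Section Calculus.
Context {R : realType} {n : nat} {M : smoothManifold R n}.

(* Vectors are rows, so that the differential of f at x is right
   multiplication by the Jacobian matrix.                                     *)
Definition vrep (c : chart R n M) (X : vfield M) (x : 'rV[R]_n) : 'rV[R]_n :=
  let p := cinv c x in
  X p *m 'J (cto c \o cinv (chart_at p)) (cto (chart_at p) p).

Definition frep (k : nat) (c : chart R n M) (a : kform M k)
    (x : 'rV[R]_n) (v : 'M[R]_(k, n)) : R :=
  let p := cinv c x in
  a p (v *m 'J (cto (chart_at p) \o cinv c) x).

Definition set_row (k : nat) (i : 'I_k) (x : 'rV[R]_n) (v : 'M[R]_(k, n)) :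
  'M[R]_(k, n) := \matrix_(j < k) (if j == i then x else row j v).

Definition multilinear (k : nat) (a : 'M[R]_(k, n) -> R) : Prop :=
  forall (i : 'I_k) (c : R) (x y : 'rV[R]_n) (v : 'M[R]_(k, n)),
    a (set_row i (c *: x + y) v) = c * a (set_row i x v) + a (set_row i y v).

Definition alternating (k : nat) (a : 'M[R]_(k, n) -> R) : Prop :=
  forall (v : 'M[R]_(k, n)) (i j : 'I_k),
    i != j -> row i v = row j v -> a v = 0.

Definition is_vfield (X : vfield M) : Prop :=
  forall c, atlas c -> smooth_map_on (cimg c) (vrep c X).

Definition is_form (k : nat) (a : kform M k) : Prop :=
  [/\ forall p, multilinear (a p),
      forall p, alternating (a p) &
      forall c, atlas c -> forall v, smooth_on (cimg c) (fun x => frep c a x v)].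

Definition is_zero (k : nat) (a : kform M k) : Prop := forall p v, a p v = 0.

(* Normalised so that (a /\ b)(v, w) = a v * b w - a w * b v on one-forms.    *)
Definition wedge (k l : nat) (a : kform M k) (b : kform M l) : kform M (k + l) :=
  fun p v => (k`! * l`!)%:R^-1 *
    \sum_(s : 'S_(k + l)) (-1) ^+ s *
      (a p (usubmx (row_perm s v)) * b p (dsubmx (row_perm s v))).

Fixpoint wedge_pow (a : kform M 2) (m : nat) : kform M m.*2 :=
  if m is m'.+1 then wedge a (@wedge_pow a m') else fun _ _ => 1.


Definition iprod (k : nat) (X : vfield M) (a : kform M k.+1) : kform M k :=
  fun p v => a p (col_mx (X p) v).

Definition ev1 (a : kform M 1) (X : vfield M) : M -> R := fun p => a p (X p).

(* (da)(v_0, .., v_k) = \sum_i (-1)^i D_{v_i} (a (.., v_i omitted, ..)),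
   computed at p in the preferred chart at p, with v_0, .., v_k constant.     *)
Definition extd (k : nat) (a : kform M k) : kform M k.+1 :=
  fun p v => let c := chart_at p in
    \sum_(i < k.+1) (-1) ^+ i *
      'D_(row i v) (fun x => frep c a x (row' i v)) (cto c p).

(* The coordinate formula
   (L_X a)_{i1 .. ik} = X^j d_j a_{i1 .. ik} + \sum_m a_{i1 .. j .. ik} d_{im} X^j,
   computed at p in the preferred chart at p.                                 *)
Definition lie (k : nat) (X : vfield M) (a : kform M k) : kform M k :=
  fun p v => let c := chart_at p in let x := cto c p in
    'D_(vrep c X x) (fun y => frep c a y v) x +
    \sum_(i < k) frep c a x (set_row i ('D_(row i v) (vrep c X) x) v).

Definition form_cast (k l : nat) (e : k = l) (a : kform M k) : kform M l :=
  fun p v => a p (castmx (esym e, erefl n) v).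

(* On top-degree forms: being a volume form.                                  *)
Definition nowhere_vanishing (mu : kform M n) : Prop :=
  forall p, exists v, mu p v != 0.

(* Both are volume forms, and they have the same positively oriented frames.  *)
Definition same_orientation (mu nu : kform M n) : Prop :=
  [/\ nowhere_vanishing mu, nowhere_vanishing nu &
      forall p v, (0 < mu p v) = (0 < nu p v)].

Definition nondegenerate (w : kform M 2) : Prop :=
  forall p (u : 'rV[R]_n),
    (forall v : 'rV[R]_n, w p (col_mx u v) = 0) -> u = 0.

(* w is a non-degenerate two-form and t is a closed one-form with dw = w /\ t,
   i.e. w is lcs and t is a Lee form of it.                                   *)
Definition lcs_with_Lee_form (w : kform M 2) (t : kform M 1) : Prop :=
  [/\ is_form w, nondegenerate w, is_form t, is_zero (extd t) &
      extd w = wedge w t].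

Definition is_reeb_pair (a b : kform M 1) (A B : vfield M) : Prop :=
  [/\ is_vfield A, is_vfield B,
      forall p, [/\ ev1 a A p = 1, ev1 b B p = 1, ev1 a B p = 0 & ev1 b A p = 0],
      is_zero (iprod A (extd a)) /\ is_zero (iprod A (extd b)) &
      is_zero (iprod B (extd a)) /\ is_zero (iprod B (extd b))].

(* The vector field X is part of the structure: it is not determined by w.     *)
Definition lcs_structures : set (kform M 2 * vfield M) :=
  [set wX | exists t, [/\ lcs_with_Lee_form wX.1 t, is_vfield wX.2,
                          is_zero (lie wX.2 wX.1) & forall p, ev1 t wX.2 p = 1]].

End Calculus.

Arguments wedge_pow {R n M} a m p v.

Lemma contact_degree (h : nat) : (1 + h.*2 + 1)%N = h.*2.+2.
Proof. by rewrite add1n addn1. Qed.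

Section ContactPairs.
Context {R : realType} {h : nat} {M : smoothManifold R h.*2.+2}.

Definition contact_volume (a b : kform M 1) : kform M h.*2.+2 :=
  form_cast (contact_degree h) (wedge (wedge a (wedge_pow (extd a) h)) b).

Definition contact_pairs : set (kform M 1 * kform M 1) :=
  [set ab | [/\ is_form ab.1, is_form ab.2,
                nowhere_vanishing (contact_volume ab.1 ab.2),
                is_zero (wedge_pow (extd ab.1) h.+1) &
                is_zero (extd ab.2)]].

End ContactPairs.

Arguments lcs_structures {R n} M.
Arguments contact_pairs {R h} M.

(* Main.v *)
Require Import Defs.
From HB Require Import structures.
From mathcomp Require Import all_boot all_order all_algebra all_fingroup.
From mathcomp Require Import ring lra.
From mathcomp Require Import all_classical all_reals all_analysis.
Set Implicit Arguments.
Unset Strict Implicit.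
Unset Printing Implicit Defensive.
Import Order.TTheory GRing.Theory Num.Theory.
Import numFieldNormedType.Exports.
Local Open Scope classical_set_scope.
Local Open Scope ring_scope.

(** To a contact pair [(alpha, beta)] the form [w = d alpha + alpha /\ beta] is
    attached, together with the field [X] defined by [i_X w = - alpha].

    Since [d beta = 0], [d w = d alpha /\ beta = w /\ beta], so [beta] is a Lee
    form of [w] ([extd_contact_lcs]).  Since [(d alpha)^(h+1) = 0] and
    [(alpha /\ beta)^2 = 0],
      [w^(h+1) = (h+1) alpha /\ (d alpha)^h /\ beta],
    so [w] is non-degenerate and induces the orientation of the contact pair
    ([exp_plus_product], [contact_pair_orientation]).  Pointwise linear algebra
    ([contact_algebra]) shows that the solutions of [i_A w = beta] and
    [i_B w = - alpha] satisfy the Reeb equations, and by non-degeneracy the Reeb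
    equations have no other solution.  Cartan's formula gives
    [L_B w = d (i_B w) + i_B (w /\ beta) = - d alpha - alpha /\ beta + w = 0].

    Conversely, let [w] be lcs with Lee form [theta], and let [X] satisfy
    [L_X w = 0] and [theta X = 1].  With [alpha = - i_X w], the same formula reads
    [w = d alpha + alpha /\ theta].  The field [L] with [i_L w = theta] is in the
    kernel of [d alpha], hence [(d alpha)^(h+1) = 0], and the displayed identity
    then shows that [alpha /\ (d alpha)^h /\ theta] vanishes nowhere, the top power
    of a non-degenerate two-form being non-zero ([power_nondegenerate],
    [lcs_algebra]).  The two constructions are inverse to each other because [w]
    determines its Lee form in dimension greater than two
    ([nondegenerate_mul_eq0]).

    Two tools carry the formal work.  At a point, forms are regarded as functions
    on words of vectors, where the exterior product becomes a signed shuffle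
    product: it is defined by the Leibniz rule for contractions, makes the words
    into a ring, and agrees with the sum over permutations on alternating forms
    ([words_wedge]).  In charts, the symmetry of second derivatives
    ([derive_comm]) makes the exterior derivative of one-forms independent of the
    chart ([words_frep_extd1]); this gives the smoothness of [d alpha] and allows
    [d d alpha = 0] and Cartan's formula to be computed in the preferred chart at
    each point.  Smoothness of [A] and [B] follows from Cramer's rule
    ([is_vfield_contraction]). *)

(** * The signed shuffle product *)

Section WordForms.
Context {R : realType} {V : Type}.

(** A [k]-form at a point is stored as a function on all words of vectors that
    vanishes on words of length other than [k].  The degree is then not part of
    the type, so that the exterior product is a genuine associative ring
    product and no casts between [k + (l + m)] and [(k + l) + m] appear. *)
Definition wform : Type := seq V -> R.
HB.instance Definition _ := GRing.Lmodule.on wform.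

Implicit Types (a b c : wform) (v : V) (s : seq V).

Lemma wformDE a b s : (a + b) s = a s + b s. Proof. by []. Qed.
Lemma wformNE a s : (- a) s = - a s. Proof. by []. Qed.
Lemma wformZE k a s : (k *: a) s = k * a s. Proof. by []. Qed.
Lemma wform0E s : (0 : wform) s = 0. Proof. by []. Qed.

Definition contract v a : wform := fun s => a (v :: s).
(** The grading automorphism: multiplication by [(-1) ^ k] in degree [k]. *)
Definition parity a : wform := fun s => (-1) ^+ size s * a s.

(** The exterior product, defined by the Leibniz rule
    [i_v (a b) = (i_v a) b + (-1)^k a (i_v b)] for contractions.  Unfolded, this
    is the signed sum over all shuffles of the word between the two factors, and
    it is associative even without any alternation of the factors. *)
Fixpoint shuffle a b s : R :=
  if s is v :: s' then
    shuffle (contract v a) b s' + shuffle (parity a) (contract v b) s'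
  else a [::] * b [::].

Lemma contractD v a b : contract v (a + b) = contract v a + contract v b.
Proof. by []. Qed.
Lemma contractZ v k a : contract v (k *: a) = k *: contract v a.
Proof. by []. Qed.
Lemma contractN v a : contract v (- a) = - contract v a.
Proof. by []. Qed.
Lemma contract0 v : contract v 0 = 0.
Proof. by []. Qed.

Lemma parityD a b : parity (a + b) = parity a + parity b.
Proof. by apply/funext => s; rewrite /parity !wformDE mulrDr. Qed.
Lemma parityZ k a : parity (k *: a) = k *: parity a.
Proof. by apply/funext => s; rewrite /parity !wformZE mulrCA. Qed.
Lemma parityK : involutive parity.
Proof.
by move=> a; apply/funext => s; rewrite /parity mulrA -expr2 sqrr_sign mul1r.
Qed.

Lemma contract_parity v a : contract v (parity a) = - parity (contract v a).
Proof.
by apply/funext => s; rewrite wformNE /contract /parity /= exprS mulN1r mulNr.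
Qed.

Lemma shuffleDl a b c : shuffle (a + b) c = shuffle a c + shuffle b c :> wform.
Proof.
apply/funext => s; elim: s a b c => [|v s IH] a b c /=.
  by rewrite !wformDE /= mulrDl.
by rewrite !contractD parityD !IH !wformDE /= addrACA.
Qed.

Lemma shuffleDr a b c : shuffle c (a + b) = shuffle c a + shuffle c b :> wform.
Proof.
apply/funext => s; elim: s a b c => [|v s IH] a b c /=.
  by rewrite !wformDE /= mulrDr.
by rewrite !contractD !IH !wformDE /= addrACA.
Qed.

Lemma shuffleZl k a b : shuffle (k *: a) b = k *: (shuffle a b : wform).
Proof.
apply/funext => s; elim: s a b => [|v s IH] a b /=.
  by rewrite !wformZE /= mulrA.
by rewrite !contractZ parityZ !IH !wformZE /= -mulrDr.
Qed.

Lemma shuffleZr k a b : shuffle a (k *: b) = k *: (shuffle a b : wform).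
Proof.
apply/funext => s; elim: s a b => [|v s IH] a b /=.
  by rewrite !wformZE /= mulrCA.
by rewrite !contractZ !IH !wformZE /= -mulrDr.
Qed.

Lemma parity_shuffle a b :
  parity (shuffle a b) = shuffle (parity a) (parity b).
Proof.
apply/funext => s; elim: s a b => [|v s IH] a b /=.
  by rewrite /parity /= !expr0 !mul1r.
rewrite !contract_parity -[- parity (contract v a)]scaleN1r.
rewrite -[- parity (contract v b)]scaleN1r shuffleZl shuffleZr.
by rewrite !wformZE -!IH /parity /= exprS; rewrite !mulrDr !mulrA.
Qed.

(** Contracting either side with the first letter produces the same three
    terms, so the claim follows by induction on the word. *)
Lemma shuffleA a b c : shuffle a (shuffle b c) = shuffle (shuffle a b) c.
Proof.
apply/funext => s; elim: s a b c => [|v s IH] a b c /=; first by rewrite mulrA.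
rewrite parity_shuffle -!IH.
have E x y : contract v (shuffle x y) =
   (shuffle (contract v x) y : wform) + shuffle (parity x) (contract v y) by [].
by rewrite !E shuffleDr shuffleDl !wformDE !IH addrA.
Qed.

Definition word_unit : wform := fun s => (nilp s)%:R.

Lemma shuffle0l a : shuffle 0 a = 0.
Proof. by rewrite -[X in shuffle X _](scale0r (0 : wform)) shuffleZl scale0r. Qed.
Lemma shuffle0r a : shuffle a 0 = 0.
Proof. by rewrite -[X in shuffle _ X](scale0r (0 : wform)) shuffleZr scale0r. Qed.

Lemma contract_unit v : contract v word_unit = 0.
Proof. exact/funext. Qed.
Lemma parity_unit : parity word_unit = word_unit.
Proof.
by apply/funext => -[|v s]; rewrite /parity /word_unit /= ?mul1r ?mulr0.
Qed.

Lemma shuffle1l a : shuffle word_unit a = a.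
Proof.
apply/funext => s; elim: s a => [|v s IH] a /=; first by rewrite mul1r.
by rewrite contract_unit shuffle0l parity_unit IH wform0E add0r.
Qed.
Lemma shuffle1r a : shuffle a word_unit = a.
Proof.
apply/funext => s; elim: s a => [|v s IH] a /=; first by rewrite mulr1.
by rewrite contract_unit shuffle0r IH wform0E addr0.
Qed.

HB.instance Definition _ := GRing.Zmodule_isPzRing.Build wform
  shuffleA shuffle1l shuffle1r shuffleDl (fun c a b => shuffleDr a b c).

Lemma wformM_nil a b : (a * b) [::] = a [::] * b [::].
Proof. by []. Qed.

Lemma contractM v a b :
  contract v (a * b) = contract v a * b + parity a * contract v b.
Proof. by []. Qed.

Lemma wformZl k a b : k *: a * b = k *: (a * b).
Proof. exact: shuffleZl. Qed.
Lemma wformZr k a b : a * (k *: b) = k *: (a * b).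
Proof. exact: shuffleZr. Qed.

Definition has_parity (p : bool) a := parity a = (-1) ^+ p *: a.

Lemma has_parity_contract p v a :
  has_parity p a -> has_parity (~~ p) (contract v a).
Proof.
rewrite /has_parity => pa; apply: oppr_inj; rewrite -contract_parity pa.
by rewrite contractZ signrN scaleNr opprK.
Qed.

(** Graded commutativity: contraction changes the parity of one factor, and the
    resulting signs match on both sides. *)
Lemma wformMC p q a b : has_parity p a -> has_parity q b ->
  a * b = (-1) ^+ (p && q) *: (b * a).
Proof.
move=> pa pb; apply/funext => s; elim: s p q a b pa pb => [|v s IH] p q a b pa pb.
  rewrite wformZE !wformM_nil mulrC.
  case: p q pa pb => [] [] pa pb; rewrite ?mul1r//.
  have : parity a [::] = a [::] by rewrite /parity mul1r.
  rewrite pa wformZE mulN1r => /eqP; rewrite eqNr => /eqP ->.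
  by rewrite !mulr0.
rewrite wformZE -!/(contract v _ s) !contractM !wformDE pa pb wformZl wformZE.
rewrite (IH _ _ _ _ (has_parity_contract v pa) pb).
rewrite (IH _ _ _ _ pa (has_parity_contract v pb)).
rewrite !wformZl !wformZE [RHS]mulrDr !mulrA addrC -!signr_addb.
by case: p q {pa pb} => [] [].
Qed.

Definition homog k a := forall s, size s != k -> a s = 0.

Lemma homogZ k x a : homog k a -> homog k (x *: a).
Proof. by move=> ha s hs; rewrite wformZE ha ?mulr0. Qed.

Lemma homogD k a b : homog k a -> homog k b -> homog k (a + b).
Proof. by move=> ha hb s hs; rewrite wformDE ha ?hb ?addr0. Qed.

Lemma homog_contract k v a : homog k a -> homog k.-1 (contract v a).
Proof. by move=> ha s hs; apply: ha => /=; case: k hs. Qed.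

Lemma homog0_contract v a : homog 0 a -> contract v a = 0.
Proof. by move=> ha; apply/funext => s; apply: ha. Qed.

Lemma homog_parity k a : homog k a -> has_parity (odd k) a.
Proof.
move=> ha; apply/funext => s; rewrite /parity wformZE.
have [<-|/ha->] := eqVneq (size s) k; last by rewrite !mulr0.
by rewrite signr_odd.
Qed.

Lemma homogM k l a b : homog k a -> homog l b -> homog (k + l)%N (a * b).
Proof.
move=> ha hb s; elim: s k l a b ha hb => [|v s IH] k l a b ha hb hs.
  rewrite wformM_nil; move: hs; rewrite /= eq_sym addn_eq0 negb_and.
  by case/orP => hs; [rewrite ha ?mul0r//|rewrite hb ?mulr0//]; rewrite eq_sym.
rewrite -/(contract v _ s) contractM wformDE (homog_parity ha) wformZl wformZE.
have -> : (contract v a * b) s = 0.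
  case: k ha hs => [|k] ha hs; first by rewrite homog0_contract// mul0r.
  by apply: (IH k l) => //; apply: homog_contract ha.
have -> : (a * contract v b) s = 0.
  case: l hb hs => [|l] hb hs; first by rewrite (homog0_contract _ hb)// mulr0.
  rewrite addnS eqSS in hs.
  by apply: (IH k l) => //; apply: homog_contract hb.
by rewrite mulr0 addr0.
Qed.

Lemma homog1 : homog 0 1.
Proof. by case. Qed.

Lemma homogX k a m : homog k a -> homog (m * k)%N (a ^+ m).
Proof.
move=> ha; elim: m => [|m IH]; first exact: homog1.
by rewrite exprS mulSn; apply: homogM.
Qed.

(** An odd form anticommutes with itself, and [2] is invertible. *)
Lemma homog_square0 k a : odd k -> homog k a -> a * a = 0.
Proof.
move=> ok /homog_parity; rewrite ok => pa.
have := wformMC pa pa; rewrite /= expr1 scaleN1r => /(congr1 (fun f : wform => f)) E.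
apply/funext => s; move/(congr1 (@^~ s)): E; rewrite wformNE => /esym/eqP.
by rewrite eqNr => /eqP.
Qed.

Lemma homog_commr k l a b : ~~ odd k -> homog k a -> homog l b -> a * b = b * a.
Proof.
move=> ek /homog_parity pa /homog_parity pb.
by rewrite (wformMC pa pb) (negbTE ek) scale1r.
Qed.

Lemma homog_anticomm k l a b : odd k -> odd l -> homog k a -> homog l b ->
  a * b = - (b * a).
Proof.
move=> ok ol /homog_parity pa /homog_parity pb.
by rewrite (wformMC pa pb) ok ol scaleN1r.
Qed.

(** Contraction is a derivation, and its odd output commutes with the even form
    [a]. *)
Lemma contract_exp v a m : homog 2 a ->
  contract v (a ^+ m.+1) = m.+1%:R *: (contract v a * a ^+ m).
Proof.
move=> ha; elim: m => [|m IH]; first by rewrite expr1 expr0 mulr1 scale1r.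
have C : a * contract v a = contract v a * a.
  exact: (homog_commr (k := 2) (l := 1) _ ha (homog_contract v ha)).
rewrite exprS contractM (homog_parity ha) scale1r IH wformZr mulrA C.
by rewrite -mulrA -exprS -[X in X + _]scale1r -scalerDl addrC natr1.
Qed.

(** The binomial formula stops after the linear term because [a * b] squares to
    zero.  For [e = d alpha] with [e ^+ m.+1 = 0] it says that the top power of
    [d alpha + alpha /\ beta] is a positive multiple of
    [alpha /\ (d alpha)^m /\ beta], which carries both the non-degeneracy of the
    lcs form and the comparison of orientations. *)
Lemma exp_plus_product (e a b : wform) m : homog 2 e -> homog 1 a -> homog 1 b ->
  (e + a * b) ^+ m.+1 = e ^+ m.+1 + m.+1%:R *: (a * e ^+ m * b).
Proof.
move=> he ha hb.
have hg : homog 2 (a * b) by apply: (homogM ha hb).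
have gg : a * b * (a * b) = 0.
  rewrite mulrA -(mulrA a) (homog_anticomm _ _ hb ha)// mulrN mulNr mulrA.
  by rewrite (homog_square0 _ ha)// !mul0r oppr0.
have Em k : a * e ^+ k * b = a * b * e ^+ k.
  rewrite -!mulrA; congr (a * _).
  by rewrite (homog_commr _ (homogX (m := k) he) hb) // muln2 odd_double.
rewrite Em; elim: m => [|m IH]; first by rewrite !expr1 !expr0 mulr1 scale1r.
rewrite exprS IH mulrDl !mulrDr -exprS !wformZr.
have -> : a * b * (a * b * e ^+ m) = 0 by rewrite mulrA gg mul0r.
have -> : e * (a * b * e ^+ m) = a * b * e ^+ m.+1.
  by rewrite mulrA (homog_commr _ he hg)// -mulrA -exprS.
by rewrite scaler0 addr0 -addrA -[X in _ + (_ + X)]scale1r -scalerDl natr1.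
Qed.

(** Every shuffle feeds some letter of the word to the covector [t]. *)
Lemma shuffle_vanish (t b : wform) s : homog 1 t ->
  (forall s1 x s2, s = s1 ++ x :: s2 -> t [:: x] = 0) -> (t * b) s = 0.
Proof.
elim: s t b => [|v s IH] t b ht H; first by rewrite wformM_nil ht ?mul0r.
rewrite -/(contract v _ s) contractM wformDE (homog_parity ht) wformZl wformZE.
have -> : contract v t = 0.
  apply/funext => -[|w r]; last by apply: ht.
  by rewrite /contract (H [::] v s).
rewrite mul0r IH ?mulr0 ?addr0// => s1 x s2 E.
by apply: (H (v :: s1) x s2); rewrite E.
Qed.

End WordForms.

(** * Antisymmetrisation and the shuffle product *)

Section Antisymmetry.
Context {R : realType} {V : Type}.
Implicit Types (a b c : @wform R V) (v : V).

Definition antisym a :=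
  forall s x y r, a (s ++ x :: y :: r) = - a (s ++ y :: x :: r).

Definition insert_at j v s := take j s ++ v :: drop j s.

(** Moving a letter to the front over [j] others costs [j] transpositions. *)
Lemma antisym_insert a j v s : antisym a -> (j <= size s)%N ->
  a (insert_at j v s) = (-1) ^+ j * a (v :: s).
Proof.
move=> aa; elim: j => [|j IH] lj; first by rewrite /insert_at take0 drop0 mul1r.
rewrite exprS mulN1r mulNr -IH ?(ltnW lj)// /insert_at.
by rewrite (take_nth v lj) (drop_nth v lj) -cats1 -catA /= aa.
Qed.

Lemma antisym_contract v a : antisym a -> antisym (contract v a).
Proof. by move=> aa s x y r; rewrite /contract -!cat_cons aa. Qed.

Lemma antisym_parity a : antisym a -> antisym (parity a).
Proof. by move=> aa s x y r; rewrite /parity aa mulrN !size_cat. Qed.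

Lemma antisymD a b : antisym a -> antisym b -> antisym (a + b).
Proof. by move=> aa ab s x y r; rewrite !wformDE aa ab opprD. Qed.

Lemma antisym_repeat a s x r u : antisym a -> a (s ++ x :: r ++ x :: u) = 0.
Proof.
move=> aa; elim: r s => [|y r IH] s.
  by apply/eqP; rewrite -eqNr /= -aa.
by rewrite /= aa -cat_rcons IH oppr0.
Qed.

Lemma antisymM a b : antisym a -> antisym b -> antisym (a * b).
Proof.
move=> + + s; elim: s a b => [|v s IH] a b aa ab x y r; last first.
  rewrite !cat_cons -!/(contract v _ _) contractM !wformDE.
  rewrite opprD; congr (_ + _); apply: IH => //.
  - exact: antisym_contract.
  - exact: antisym_parity.
  - exact: antisym_contract.
rewrite /= -![_ (x :: y :: r)]/(contract y (contract x _) r).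
rewrite -![_ (y :: x :: r)]/(contract x (contract y _) r).
rewrite !contractM !contractD !contractM !wformDE !contract_parity !mulNr.
rewrite !wformNE !parityK.
have E c : antisym c -> contract y (contract x c) = - contract x (contract y c).
  by move=> ac; apply/funext => w; rewrite /contract wformNE; apply: (ac [::]).
rewrite (E a)// (E b)// mulNr mulrN !wformNE; lra.
Qed.

Lemma antisymX a m : antisym a -> antisym (a ^+ m).
Proof.
move=> aa; elim: m => [|m IH]; last by rewrite exprS; apply: antisymM.
by move=> [|? s] x y r; rewrite oppr0.
Qed.

(** The rows of [row_perm s t], read as a word. *)
Definition perm_word N (t : 'I_N -> V) (s : 'S_N) : seq V :=
  [seq t (s i) | i <- enum 'I_N].

Lemma size_perm_word N (t : 'I_N -> V) s : size (perm_word t s) = N.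
Proof. by rewrite size_map size_enum_ord. Qed.

Lemma nth_perm_word N (t : 'I_N -> V) s x0 (i : 'I_N) :
  nth x0 (perm_word t s) i = t (s i).
Proof. by rewrite (nth_map i) ?size_enum_ord// nth_ord_enum. Qed.

Lemma perm_word_lift N (t : 'I_N.+1 -> V) (j : 'I_N.+1) (s : 'S_N) :
  perm_word t (lift_perm j ord0 s) =
  insert_at j (t ord0) (perm_word (fun i => t (lift ord0 i)) s).
Proof.
have sj : (j <= size (perm_word (fun i => t (lift ord0 i)) s))%N.
  by rewrite size_perm_word -ltnS.
apply: (@eq_from_nth _ (t ord0)) => [|i].
  rewrite size_perm_word /insert_at size_cat /= addnS -size_cat cat_take_drop.
  by rewrite size_perm_word.
rewrite size_perm_word => iN; rewrite -[i]/(val (Ordinal iN)) nth_perm_word.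
case: (unliftP j (Ordinal iN)) => [i' ->|->].
  rewrite lift_perm_lift /insert_at nth_cat size_takel//= /bump.
  case: (leqP j i') => ij.
    rewrite ltnNge (leq_trans ij)// add1n subSn//= nth_drop subnKC//.
    by rewrite nth_perm_word.
  by rewrite add0n ij nth_take// nth_perm_word.
by rewrite lift_perm_id /insert_at nth_cat size_takel// ltnn subnn.
Qed.

(** The sum over permutations in the definition of the wedge product, without its
    normalising factor. *)
Definition alt_sum k a b N (t : 'I_N -> V) : R :=
  \sum_(s : 'S_N) (-1) ^+ s *
    (a (take k (perm_word t s)) * b (drop k (perm_word t s))).

(** Permutations are grouped by the position [j] to which the first letter is
    sent; [lift_perm] identifies each group with the permutations of the rest. *)
Lemma alt_sum_recl k a b N (t : 'I_N.+1 -> V) :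
  alt_sum k a b t = \sum_(j < N.+1) (-1) ^+ j * \sum_(s : 'S_N) (-1) ^+ s *
    let w := insert_at j (t ord0) (perm_word (fun i => t (lift ord0 i)) s) in
    (a (take k w) * b (drop k w)).
Proof.
rewrite /alt_sum (partition_big (fun s : 'S_N.+1 => (s^-1)%g ord0) predT)//=.
apply: eq_bigr => j _; rewrite mulr_sumr.
pose ulsf i (s : 'S_N.+1) k0 := odflt k0 (unlift (s i) (s (lift i k0))).
have ulsfK i (s : 'S_N.+1) k0 : lift (s i) (ulsf i s k0) = s (lift i k0).
  rewrite /ulsf; have:= neq_lift i k0.
  by rewrite -(can_eq (permK s)) => /unlift_some[] ? ? ->.
have inj_ulsf : injective (ulsf j _).
  move=> s; apply: can_inj (ulsf (s j) s^-1%g) _ => k'.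
  by rewrite {1}/ulsf ulsfK !permK liftK.
rewrite (reindex_onto (lift_perm j ord0) (fun s => perm (inj_ulsf s))) /=; last first.
  move=> s /eqP E; have sj : s j = ord0 by rewrite -E permKV.
  apply/permP => i; case: (unliftP j i) => [i'|] ->.
    by rewrite lift_perm_lift permE -[X in lift X]sj ulsfK.
  by rewrite lift_perm_id.
apply: eq_big => s.
  have -> : ((lift_perm j ord0 s)^-1)%g ord0 = j.
    by apply: (@perm_inj _ (lift_perm j ord0 s)); rewrite permKV lift_perm_id.
  rewrite eqxx /=; apply/eqP/permP => i; rewrite permE /ulsf.
  by rewrite lift_perm_lift lift_perm_id liftK.
move=> _; rewrite perm_word_lift odd_lift_perm !signr_addb /= mulr1 signr_odd.
by rewrite -mulrA.
Qed.

Lemma card_ord_lt N k : (k <= N)%N -> #|[pred j : 'I_N | (j < k)%N]| = k.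
Proof.
move=> kN; have wi : injective (widen_ord kN).
  by move=> x y /(congr1 val) /= /val_inj.
rewrite -[RHS]card_ord -(card_codom wi).
apply: eq_card => j; apply/idP/codomP => [jk|[i ->]]; last by rewrite inE /= ltn_ord.
by exists (Ordinal jk); apply: val_inj.
Qed.

Definition degree_part k a : wform := fun s => if size s == k then a s else 0.

Lemma contract_degree_part k v a :
  contract v (degree_part k.+1 a) = degree_part k (contract v a).
Proof. by []. Qed.

Lemma homog_degree_part k a : homog k (degree_part k a).
Proof. by move=> s; rewrite /degree_part => /negbTE ->. Qed.

Lemma homogM_short k a b s : homog k a -> (size s < k)%N -> (a * b) s = 0.
Proof.
elim: s k a b => [|v s IH] k a b ha sk.
  by case: k ha sk => // k ha _; rewrite wformM_nil ha ?mul0r.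
rewrite -/(contract v _ s) contractM wformDE (homog_parity ha) wformZl wformZE.
rewrite (IH k a _ ha) ?(ltnW sk)// mulr0 addr0; apply: (IH k.-1).
  exact: homog_contract.
by case: k sk {ha}.
Qed.

(** By induction on the number of letters: the first letter lands either in the
    block of [a] or in the block of [b].  Antisymmetry makes all positions inside
    a block contribute equally, and the number of positions turns
    [(k-1)! (N-k)!], resp. [k! (N-k-1)!], into [k! (N-k)!].  What remains is the
    Leibniz rule defining the shuffle product. *)
Lemma alt_sum_shuffle k a b N (t : 'I_N -> V) : antisym a -> antisym b ->
  (k <= N)%N ->
  alt_sum k a b t = (k`! * (N - k)`!)%:R * (degree_part k a * b) (codom t).
Proof.
elim: N k a b t => [|N IH] k a b t aa ab kN.
  move: kN; rewrite leqn0 => /eqP ->; rewrite /alt_sum.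
  have -> : codom t = [::] by apply: size0nil; rewrite size_codom card_ord.
  rewrite wformM_nil fact0 !mul1r (big_pred1 1%g); last first.
    move=> s; have -> : s = 1%g by apply/permP => -[].
    by rewrite /= eqxx.
  rewrite odd_perm1 mul1r /degree_part /=.
  have -> : perm_word t 1%g = [::] by apply: size0nil; rewrite size_perm_word.
  by [].
set t' := fun i => t (lift ord0 i).
have -> : codom t = t ord0 :: codom t'.
  by rewrite /codom /image_mem enum_ordSl /= -map_comp.
set v := t ord0.
rewrite -/(contract v _ _) contractM wformDE.
rewrite (homog_parity (@homog_degree_part k a)) wformZl wformZE mulrDr.
rewrite alt_sum_recl -/t' -/v (bigID (fun j : 'I_N.+1 => (j < k)%N)) /=.
congr (_ + _).
  case: k kN => [|k] kN.
    rewrite big_pred0// (homog0_contract v (@homog_degree_part 0 a)).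
    by rewrite mul0r wform0E mulr0.
  rewrite contract_degree_part subSS.
  have -> : (k.+1`! * (N - k)`!)%:R * (degree_part k (contract v a) * b) (codom t')
     = k.+1%:R * alt_sum k (contract v a) b t'.
    by rewrite IH//; [rewrite factS !natrM !mulrA|exact: antisym_contract].
  rewrite (eq_bigr (fun=> alt_sum k (contract v a) b t')).
    rewrite sumr_const mulr_natl; congr (_ *+ _).
    by rewrite -[RHS](card_ord_lt kN); apply: eq_card.
  move=> j jk; rewrite mulr_sumr; apply: eq_bigr => s _ /=.
  set w := perm_word t' s.
  have sw : size w = N by rewrite size_perm_word.
  have jw : (j <= size w)%N by rewrite sw -ltnS.
  have E1 : take k.+1 (insert_at j v w) = insert_at j v (take k w).
    rewrite /insert_at take_cat size_takel// ltnNge (ltnW jk)/= subSn//=.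
    rewrite take_takel//.
 by rewrite take_drop subnK.
  have E2 : drop k.+1 (insert_at j v w) = drop k w.
    rewrite /insert_at drop_cat size_takel// ltnNge (ltnW jk)/= subSn//=.
    by rewrite drop_drop subnK.
  rewrite E1 E2 antisym_insert//; last by rewrite size_takel// sw.
  have /= := sqrr_sign R j; rewrite expr2 /contract.
  move: ((-1) ^+ j) ((-1) ^+ s) (a _) (b _) => e x y z ee.
  have -> : e * (x * (e * y * z)) = e * e * (x * (y * z)) by ring.
  by rewrite ee mul1r.
case: (leqP k N) => [kN'|Nk]; last first.
  rewrite big_pred0; last first.
    by move=> j; apply/negbF; apply: leq_trans (ltn_ord j) Nk.
  by rewrite (homogM_short _ (@homog_degree_part k a)) ?mulr0// size_codom card_ord.
have -> : (k`! * (N.+1 - k)`!)%:R *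
    ((-1) ^+ odd k * (degree_part k a * contract v b) (codom t')) =
    (N.+1 - k)%:R * ((-1) ^+ k * alt_sum k a (contract v b) t').
  rewrite IH//; last exact: antisym_contract.
  rewrite subSn// factS !natrM signr_odd.
  by move: (_%:R) (_%:R) (_%:R) ((-1) ^+ k) (_ (codom t')) => x y z e u; ring.
rewrite (eq_bigr (fun=> (-1) ^+ k * alt_sum k a (contract v b) t')).
  rewrite sumr_const mulr_natl; congr (_ *+ _).
  have := cardC [pred j : 'I_N.+1 | (j < k)%N].
  rewrite card_ord (card_ord_lt kN) => C.
  by rewrite -[X in (X - k)%N]C addKn; apply: eq_card.
move=> j; rewrite -leqNgt => kj; rewrite /alt_sum !mulr_sumr.
apply: eq_bigr => s _ /=.
set w := perm_word t' s.
have sw : size w = N by rewrite size_perm_word.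
have jw : (j <= size w)%N by rewrite sw -ltnS.
have E1 : take k (insert_at j v w) = take k w.
  rewrite /insert_at take_cat size_takel//; case: ltnP => [kj'|jk].
    by rewrite take_takel// ltnW.
  have -> : nat_of_ord j = k by apply/eqP; rewrite eqn_leq kj jk.
  by rewrite subnn take0 cats0.
have E2 : drop k (insert_at j v w) = insert_at (j - k) v (drop k w).
  rewrite /insert_at drop_cat size_takel//; case: ltnP => [kj'|jk].
    by rewrite take_drop drop_drop !subnK.
  have -> : nat_of_ord j = k by apply/eqP; rewrite eqn_leq kj jk.
  by rewrite subnn !drop0 take0.
rewrite E1 E2 antisym_insert ?size_drop ?leq_sub2r//.
have -> : (-1) ^+ j = (-1) ^+ (j - k) * (-1) ^+ k :> R by rewrite -exprD subnK.
have := sqrr_sign R (j - k); rewrite expr2 /contract.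
move: ((-1) ^+ (j - k)) ((-1) ^+ k) ((-1) ^+ s) (a _) (b _) => e x y z t1 ee.
have -> : e * x * (y * (z * (e * t1))) = e * e * (x * (y * (z * t1))) by ring.
by rewrite ee mul1r.
Qed.

End Antisymmetry.

(** * Alternating forms at a point as words *)

Section PointForms.
Context {R : realType} {n : nat}.
Local Notation V := 'rV[R]_n.
Local Notation wform := (@wform R V).
Implicit Types (a b c : wform) (u x y : V) (s r : seq V).

Definition mx_word k (s : seq V) : 'M[R]_(k, n) := \matrix_(i < k) nth 0 s i.
Definition mx_rows k (v : 'M[R]_(k, n)) : seq V := [seq row i v | i <- enum 'I_k].

Definition words k (f : 'M[R]_(k, n) -> R) : wform :=
  fun s => if size s == k then f (mx_word k s) else 0.

Lemma mx_rowsK k (v : 'M[R]_(k, n)) : mx_word k (mx_rows v) = v.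
Proof.
apply/row_matrixP => i; rewrite rowK (nth_map i) ?size_enum_ord//.
by rewrite nth_ord_enum.
Qed.

Lemma words_rows k (f : 'M[R]_(k, n) -> R) v : words f (mx_rows v) = f v.
Proof. by rewrite /words size_map size_enum_ord eqxx mx_rowsK. Qed.

Lemma words_inj k (f g : 'M[R]_(k, n) -> R) : words f = words g -> f =1 g.
Proof. by move=> E v; rewrite -words_rows E words_rows. Qed.

Lemma homog_words k (f : 'M[R]_(k, n) -> R) : homog k (words f).
Proof. by move=> s /negbTE sk; rewrite /words sk. Qed.

Definition wlinear a := forall s k x y r,
  a (s ++ (k *: x + y) :: r) = k * a (s ++ x :: r) + a (s ++ y :: r).

Lemma mx_word_set_row k (s r : seq V) x z (i : 'I_k) : val i = size s ->
  mx_word k (s ++ x :: r) = set_row i x (mx_word k (s ++ z :: r)).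
Proof.
move=> si; apply/row_matrixP => j; rewrite !rowK; case: eqVneq => [->|ji].
  by rewrite si nth_cat ltnn subnn.
rewrite !nth_cat; case: ltngtP => // js; last first.
  by case/eqP: ji; apply: val_inj; rewrite si.
by move: js; rewrite -subn_gt0; case: (_ - _)%N.
Qed.

Lemma wlinear_words k (f : 'M[R]_(k, n) -> R) :
  multilinear f -> wlinear (words f).
Proof.
move=> fl s c x y r; rewrite /words !size_cat /=.
case: eqVneq => [E|_]; last by rewrite mulr0 addr0.
have si : (size s < k)%N by rewrite -E addnS ltnS leq_addr.
have S z := @mx_word_set_row k s r z 0 (Ordinal si) erefl.
by rewrite (S (c *: x + y)) (S x) (S y); apply: fl.
Qed.

Lemma wlinear_contract u a : wlinear a -> wlinear (contract u a).
Proof. by move=> la s k x y r; rewrite /contract -!cat_cons la. Qed.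

Lemma wlinear_parity a : wlinear a -> wlinear (parity a).
Proof.
by move=> la s k x y r; rewrite /parity la !size_cat mulrDr mulrCA.
Qed.

Lemma wlinearD a b : wlinear a -> wlinear b -> wlinear (a + b).
Proof. by move=> la lb s k x y r; rewrite !wformDE la lb; ring. Qed.

Lemma wlinearM a b : wlinear a -> wlinear b -> wlinear (a * b).
Proof.
move=> + + s; elim: s a b => [|v s IH] a b la lb k x y r; last first.
  rewrite !cat_cons -!/(contract v _ _) contractM !wformDE.
  rewrite (IH _ _ (wlinear_contract v la) lb).
  by rewrite (IH _ _ (wlinear_parity la) (wlinear_contract v lb)); ring.
have E c : wlinear c ->
    contract (k *: x + y) c = k *: contract x c + contract y c.
  by move=> lc; apply/funext => w; rewrite wformDE wformZE; apply: (lc [::]).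
rewrite /= -!/(contract _ _ _) !contractM !E// mulrDl mulrDr.
by rewrite wformZl wformZr !wformDE !wformZE; ring.
Qed.

Lemma wlinearX a m : wlinear a -> wlinear (a ^+ m).
Proof.
move=> la; elim: m => [|m IH]; last by rewrite exprS; apply: wlinearM.
by move=> [|? s] k x y r; rewrite mulr0 addr0.
Qed.

Lemma wlinear0 a s r : wlinear a -> a (s ++ 0 :: r) = 0.
Proof.
move=> la; have := la s (-1) 0 0 r.
by rewrite scaler0 addr0 mulN1r addNr.
Qed.

Lemma wlinearZ a s k x r : wlinear a -> a (s ++ (k *: x) :: r) = k * a (s ++ x :: r).
Proof. by move=> la; rewrite -[k *: x]addr0 la wlinear0// addr0. Qed.

Lemma wlinear_sum a s m (k : 'I_m -> R) (x : 'I_m -> V) r : wlinear a ->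
  a (s ++ (\sum_i k i *: x i) :: r) = \sum_i k i * a (s ++ x i :: r).
Proof.
move=> la; rewrite (big_morph (fun x => a (s ++ x :: r)) (id1 := 0) (op1 := +%R)).
- by apply: eq_bigr => i _; rewrite wlinearZ.
- by move=> y z /=; rewrite -[y in LHS]scale1r la mul1r.
- exact: wlinear0.
Qed.

(** Polarisation of the vanishing on words with two equal neighbours. *)
Lemma antisym_words k (f : 'M[R]_(k, n) -> R) :
  multilinear f -> Defs.alternating f -> antisym (words f).
Proof.
move=> fl fa; have wl := wlinear_words fl.
have rep s x r : words f (s ++ x :: x :: r) = 0.
  rewrite /words size_cat /=; case: eqVneq => // E.
  have si : (size s < k)%N by rewrite -E !addnS ltnS ltnW// ltnS leq_addr.
  have si' : ((size s).+1 < k)%N by rewrite -E !addnS !ltnS leq_addr.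
  apply: (fa _ (Ordinal si) (Ordinal si')).
    by rewrite -val_eqE /= neq_ltn ltnSn.
  by rewrite !rowK /= !nth_cat ltnn ltnNge leqnSn /= subnn subSnn.
have add s x y r : words f (s ++ (x + y) :: r) =
    words f (s ++ x :: r) + words f (s ++ y :: r).
  by rewrite -[x in LHS]scale1r wl mul1r.
move=> s x y r; have := rep s (x + y) r.
rewrite add -(cat_rcons x) -(cat_rcons y) !add !cat_rcons !rep add0r addr0.
by move=> /eqP; rewrite addr_eq0 => /eqP.
Qed.

Lemma words_cast k l (e : k = l) (f : 'M[R]_(k, n) -> R) :
  words (fun v : 'M[R]_(l, n) => f (castmx (esym e, erefl n) v)) = words f.
Proof.
by case: _ / e; congr words; apply/funext => v; rewrite castmx_id.
Qed.

(** The wedge product of forms is the product of their words: this is what gives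
    access to associativity and graded commutativity. *)
Lemma words_wedge (M : smoothManifold R n) k l (f : kform M k) (g : kform M l) p :
  antisym (words (f p)) -> antisym (words (g p)) ->
  words (wedge f g p) = words (f p) * words (g p).
Proof.
move=> af ag; apply/funext => s; rewrite {1}/words.
case: eqVneq => [sk|sk]; last first.
  by rewrite (homogM (@homog_words k (f p)) (@homog_words l (g p))).
pose t (i : 'I_(k + l)) : V := nth 0 s i.
have codt : codom t = s.
  by apply: (@eq_from_nth _ 0) => [|i]; rewrite size_codom card_ord// => ik;
    rewrite -[i]/(val (Ordinal ik)) /codom (nth_map (Ordinal ik)) ?size_enum_ord//
    nth_ord_enum.
have := alt_sum_shuffle t af ag (leq_addr l k).
rewrite codt addKn.
have -> : degree_part k (words (f p)) = words (f p).
  by apply/funext => w; rewrite /degree_part /words; case: eqP.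
rewrite /wedge => E; apply: (@mulfI _ (k`! * l`!)%:R).
  by rewrite pnatr_eq0 muln_eq0 negb_or -!lt0n !fact_gt0.
rewrite mulrA mulfV ?mul1r; last first.
  by rewrite pnatr_eq0 muln_eq0 negb_or -!lt0n !fact_gt0.
rewrite -E /alt_sum; apply: eq_bigr => q _; congr (_ * (_ * _)).
  rewrite /words size_takel ?size_perm_word ?leq_addr// eqxx; congr (f p _).
  apply/row_matrixP => i; rewrite rowK nth_take//.
  have -> : nat_of_ord i = lshift l i by [].
  by rewrite nth_perm_word; apply/rowP => j; rewrite !mxE.
rewrite /words size_drop size_perm_word addKn eqxx; congr (g p _).
apply/row_matrixP => i; rewrite rowK nth_drop.
have -> : (k + i)%N = rshift k i by [].
by rewrite nth_perm_word; apply/rowP => j; rewrite !mxE.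
Qed.

Lemma words_wedge_pow (M : smoothManifold R n) (w : kform M 2) m p :
  antisym (words (w p)) -> words (wedge_pow w m p) = words (w p) ^+ m.
Proof.
move=> aw; elim: m => [|m IH].
  by apply/funext => -[|x s].
have am : antisym (words (wedge_pow w m p)) by rewrite IH; apply: antisymX.
by rewrite exprS -IH; exact: (words_wedge aw am).
Qed.

Lemma words_iprod (M : smoothManifold R n) k (X : vfield M) (f : kform M k.+1) p :
  words (iprod X f p) = contract (X p) (words (f p)).
Proof.
apply/funext => s; rewrite /words /contract /= eqSS; case: eqP => // sk.
rewrite /iprod; congr (f p _); apply/row_matrixP => i; rewrite [RHS]rowK.
case: (unliftP ord0 i) => [j|] ->.
  have -> : lift ord0 j = rshift 1 j by apply: val_inj.
  transitivity (row j (mx_word k s)); last by rewrite rowK.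
  exact: (@rowKd _ 1 k).
have -> : ord0 = lshift k (ord0 : 'I_1) by apply: val_inj.
transitivity (row ord0 (X p)); last by apply/rowP => j; rewrite !mxE.
exact: (@rowKu _ 1 k).
Qed.

End PointForms.

(** * Linear algebra of contact pairs and symplectic forms *)

Section LinearAlgebra.
Context {R : realType} {n : nat}.
Local Notation V := 'rV[R]_n.
Local Notation wform := (@wform R V).
Implicit Types (a b e t w : wform) (u x y : V) (s r : seq V).

Definition covector a : V := \row_j a [:: delta_mx 0 j].
Definition gram w : 'M[R]_n := \matrix_(i, j) w [:: delta_mx 0 i; delta_mx 0 j].
(** The vector [u] with [contract u w = a], when [w] is non-degenerate. *)
Definition sharp w a : V := covector a *m invmx (gram w).
Definition nondegenerate_word w := forall u, contract u w = 0 -> u = 0.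

Lemma covectorE a x : wlinear a -> a [:: x] = (x *m (covector a)^T) 0 0.
Proof.
move=> la; rewrite [in LHS](row_sum_delta x) mxE (wlinear_sum [::] _ _ [::] la).
by apply: eq_bigr => i _; rewrite !mxE.
Qed.

Lemma gramE w x y : wlinear w -> w [:: x; y] = (x *m gram w *m y^T) 0 0.
Proof.
move=> lw; rewrite [in LHS](row_sum_delta y) (wlinear_sum [:: x] _ _ [::] lw).
rewrite mxE; apply: eq_bigr => j _; rewrite !mxE mulrC; congr (_ * _).
rewrite [in LHS](row_sum_delta x) (wlinear_sum [::] _ _ [:: delta_mx 0 j] lw).
by apply: eq_bigr => i _; rewrite mxE.
Qed.

Lemma homog1_ext a b : homog 1 a -> homog 1 b -> (forall x, a [:: x] = b [:: x]) ->
  a = b.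
Proof.
move=> ha hb ab; apply/funext => -[|x [|y s]]; rewrite ?ab//;
by rewrite ha// hb.
Qed.

Lemma homog_eq0 k a : homog k a -> (forall s, size s = k -> a s = 0) -> a = 0.
Proof. by move=> ha a0; apply/funext => s; have [/a0|/ha] := eqVneq (size s) k. Qed.

Lemma antisym_homog1 a : homog 1 a -> antisym a.
Proof. by move=> ha s x y r; rewrite !ha ?oppr0// size_cat /= !addnS. Qed.

Lemma contract_homog1 u a : homog 1 a -> contract u a = a [:: u] *: (1 : wform).
Proof.
move=> ha; apply/funext => -[|x s]; rewrite wformZE /contract; first by rewrite mulr1.
by rewrite ha// mulr0.
Qed.

Lemma contract_wedge11 u a b : homog 1 a -> homog 1 b ->
  contract u (a * b) = a [:: u] *: b - b [:: u] *: a.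
Proof.
move=> ha hb; rewrite contractM !contract_homog1// (homog_parity ha) scaleN1r.
by rewrite wformZl mul1r mulNr wformZr mulr1.
Qed.

Lemma antisym_diag w u : antisym w -> w [:: u; u] = 0.
Proof. by move=> aw; apply: (antisym_repeat [::] u [::] [::] aw). Qed.

Lemma gram_unit w : homog 2 w -> wlinear w -> nondegenerate_word w ->
  gram w \in unitmx.
Proof.
move=> hw lw nw; rewrite -row_free_unit -kermx_eq0.
apply/rowV0P => u /sub_kermxP uK; apply: nw.
apply: (@homog_eq0 1 _ (homog_contract u hw)).
 move=> -[|y [|? ?]]// _.
by rewrite /contract gramE// uK mul0mx mxE.
Qed.

Lemma contract_sharp w a : homog 2 w -> wlinear w -> nondegenerate_word w ->
  homog 1 a -> wlinear a -> contract (sharp w a) w = a.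
Proof.
move=> hw lw nw ha la; apply: (homog1_ext (homog_contract _ hw) ha) => x.
rewrite /contract gramE// /sharp mulmxKV ?gram_unit// (covectorE _ la).
have -> : x *m (covector a)^T = (covector a *m x^T)^T by rewrite trmx_mul trmxK.
by rewrite [RHS]mxE.
Qed.

Lemma contractB w u u' : wlinear w -> contract (u - u') w = contract u w - contract u' w.
Proof.
move=> lw; apply/funext => s; rewrite wformDE wformNE /contract.
have := lw [::] (-1) u' u s; rewrite /= scaleN1r addrC => ->.
by rewrite mulN1r addrC.
Qed.

Lemma nondegenerate_contract_inj w u u' : wlinear w -> nondegenerate_word w ->
  contract u w = contract u' w -> u = u'.
Proof.
move=> lw nw E; apply/eqP; rewrite -subr_eq0; apply/eqP/nw.
by rewrite contractB// E subrr.
Qed.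

(** Fewer equations than unknowns. *)
Lemma exists_kernel m (K : 'M[R]_(n, m)) : (m < n)%N ->
  exists2 u : V, u != 0 & u *m K = 0.
Proof.
move=> mn; have /rowV0Pn[u /sub_kermxP uK u0] : kermx K != 0.
  rewrite -mxrank_eq0 mxrank_ker subn_eq0 -ltnNge.
  exact: leq_ltn_trans (rank_leq_col K) mn.
by exists u.
Qed.

(** The letters of a word of length [n] either form a basis or are dependent; in
    both cases a non-trivial combination [c] of them is a multiple of [u].
    Replacing the [j]-th letter by this combination multiplies the value by
    [c_j], since repeated letters contribute nothing, and gives a word containing
    a multiple of [u], on which [a] vanishes. *)
Lemma top_degenerate a u s : antisym a -> wlinear a -> u != 0 ->
  contract u a = 0 -> size s = n -> a s = 0.
Proof.
move=> aa la u0 ua sn; pose v := mx_word n s.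
have [c [k [c0 cv]]] : exists c : V, exists k : R, c != 0 /\ c *m v = k *: u.
  have [vu|] := boolP (v \in unitmx).
    exists (u *m invmx v), 1; rewrite mulmxKV// scale1r; split=> //.
    by apply: contraNneq u0 => /(congr1 (mulmx^~ v)); rewrite mulmxKV// mul0mx => ->.
  rewrite -row_free_unit -kermx_eq0 => /rowV0Pn[c /sub_kermxP cv c0].
  by exists c, 0; rewrite scale0r.
have [j cj] : exists j, c 0 j != 0 by apply/rV0Pn.
have js : (j < size s)%N by rewrite sn.
pose f x := a (take j s ++ x :: drop j.+1 s).
have fi (i : 'I_n) : f (row i v) = (i == j)%:R * a s.
  rewrite /f rowK; case: eqVneq => [->|ij].
    by rewrite mul1r -drop_nth// cat_take_drop.
  rewrite mul0r; have is_ : (i < size s)%N by rewrite sn.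
  case: (ltngtP i j) => [lij|lji|/val_inj/eqP]; last by rewrite (negbTE ij).
    have it : (i < size (take j s))%N by rewrite size_takel ?(ltnW js).
    rewrite -(cat_take_drop i (take j s)) (drop_nth 0 it) nth_take//.
    by rewrite -catA /= antisym_repeat.
  have it : (i - j.+1 < size (drop j.+1 s))%N 
    by rewrite size_drop sn ltn_sub2r// (leq_ltn_trans lji (ltn_ord i)).
  rewrite -(cat_take_drop (i - j.+1) (drop j.+1 s)) (drop_nth 0 it) nth_drop subnKC//.
  exact: antisym_repeat.
have : f (c *m v) = c 0 j * a s.
  rewrite mulmx_sum_row /f wlinear_sum//.
  rewrite (bigD1 j)//= -/(f _) fi eqxx mul1r big1 ?addr0// => i ij.
  by rewrite -/(f _) fi (negbTE ij) mul0r mulr0.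
rewrite cv /f wlinearZ//.
have st : (j <= size (take j s ++ drop j.+1 s))%N.
  by rewrite size_cat size_takel ?(ltnW js)// leq_addr.
have := antisym_insert u aa st.
rewrite /insert_at take_size_cat ?size_takel ?(ltnW js)//.
rewrite drop_size_cat ?size_takel ?(ltnW js)// => ->.
rewrite -[a (u :: _)]/(contract u a _) ua !mulr0 => /esym/eqP.
by rewrite mulf_eq0 (negbTE cj) => /eqP.
Qed.

Lemma top_power_degenerate w u m : homog 2 w -> antisym w -> wlinear w ->
  (m.+1 * 2)%N = n -> u != 0 -> contract u w = 0 -> w ^+ m.+1 = 0.
Proof.
move=> hw aw lw mn u0 uw; apply: (homog_eq0 (homogX hw)) => s; rewrite mn.
apply: top_degenerate u0 _; [exact: antisymX|exact: wlinearX|].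
by rewrite contract_exp// uw mul0r scaler0.
Qed.

Lemma covector_word (t : 'cV[R]_n) : exists a, [/\ homog 1 a, wlinear a &
  forall x, a [:: x] = (x *m t) 0 0].
Proof.
exists (fun s => if s is [:: x] then (x *m t) 0 0 else 0); split=> //.
  by case=> [|x [|y s]].
by move=> [|z [|z' s]] k x y [|y' r]; rewrite /= ?mulr0 ?addr0// mulmxDl -scalemxAl !mxE.
Qed.

(** If [w ^+ m.+1 = 0], then contracting with the vector that corresponds to a
    covector [t] gives [t * w ^+ m = 0], for every [t].  A word [s] of length
    [2m < n] is annihilated by some non-zero [t]; evaluating [t * w ^+ m] on
    [Y :: s] with [t Y = 1] leaves [w ^+ m] at [s], so [w ^+ m] vanishes too.
    Descending to [m = 0] contradicts [w ^+ 0 = 1]. *)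
Lemma power_nondegenerate w m : homog 2 w -> wlinear w ->
  nondegenerate_word w -> (m * 2 <= n)%N -> w ^+ m <> 0.
Proof.
move=> hw lw nw; elim: m => [_ /(congr1 (@^~ [::]))/eqP|m IH mn w0].
  by rewrite expr0 oner_eq0.
apply: IH; first by rewrite (leq_trans _ mn)// leq_mul2r leqnSn orbT.
apply: (homog_eq0 (homogX hw)) => s sm.
have [z z0 zv] : exists2 z : V, z != 0 & z *m (mx_word (m * 2) s)^T = 0.
  by apply: exists_kernel; apply: leq_trans mn; rewrite mulSn ltnS leqnSn.
have [a [ha la aE]] := covector_word z^T.
have /rV0Pn[i zi] := z0.
(* normalised so that [a Y = 1] *)
pose Y : V := (z 0 i)^-1 *: delta_mx 0 i.
have aY : a [:: Y] = 1.
  by rewrite aE -scalemxAl -rowE !mxE mulVf.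
have avan s1 x s2 : s = s1 ++ x :: s2 -> a [:: x] = 0.
  move=> E; rewrite aE.
  have si : (size s1 < m * 2)%N by rewrite -sm E size_cat /= addnS ltnS leq_addr.
  have -> : x = row (Ordinal si) (mx_word (m * 2) s).
    by rewrite rowK /= E nth_cat ltnn subnn.
  rewrite -row_mul -[_ *m _]trmxK trmx_mul trmxK zv.
  by rewrite !mxE.
have aw0 : a * w ^+ m = 0.
  apply: (@scalerI R _ m.+1%:R); first by rewrite pnatr_eq0.
  by rewrite -[a in LHS](contract_sharp hw lw nw ha la) -contract_exp// w0 scaler0.
have := congr1 (fun f : wform => f (Y :: s)) aw0.
rewrite -/(contract Y (a * _) s) contractM contract_homog1// aY scale1r mul1r.
rewrite wformDE (homog_parity ha) wformZl wformZE (shuffle_vanish _ ha)//.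
by rewrite mulr0 addr0.
Qed.

(** The vector [A], resp. [B], is the one that [w] pairs to [b], resp. to [- a].
    Antisymmetry of [w] yields [b A = a B = 0] and [b B = a A].  The remaining
    point is [a A = 1]: the contraction of [e] with [A] is [(1 - a A) b], so that
    contracting [e ^+ h.+1 = 0] with [A] gives [(1 - a A) b e^h = 0], and
    [b e^h <> 0] because [a e^h b <> 0]. *)
Lemma contact_algebra h e a b : n = h.*2.+2 ->
  homog 2 e -> antisym e -> wlinear e -> homog 1 a -> wlinear a ->
  homog 1 b -> wlinear b ->
  e ^+ h.+1 = 0 -> a * e ^+ h * b <> 0 ->
  let w := e + a * b in
  let A := sharp w b in let B := sharp w (- a) in
  [/\ nondegenerate_word w,
      contract A e = 0 /\ contract B e = 0,
      a [:: A] = 1 /\ a [:: B] = 0 &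
      b [:: A] = 0 /\ b [:: B] = 1].
Proof.
move=> nh he ae le ha la hb lb eh vol w A B.
have hab : homog 2 (a * b) by apply: (homogM ha hb).
have hw : homog 2 w by apply: homogD.
have aw : antisym w.
  by apply: antisymD => //; apply: antisymM; apply: antisym_homog1.
have lw : wlinear w by apply: wlinearD => //; apply: wlinearM.
have wh : w ^+ h.+1 = h.+1%:R *: (a * e ^+ h * b).
  by rewrite /w exp_plus_product// eh add0r.
have nw : nondegenerate_word w.
  move=> u uw; apply/eqP/negPn/negP => u0; apply: vol.
  apply: (@scalerI R _ h.+1%:R); first by rewrite pnatr_eq0.
  rewrite -wh scaler0; apply: top_power_degenerate u0 uw => //.
  by rewrite mulSn muln2 nh.
have Aw : contract A w = b by apply: contract_sharp.
have hNa : homog 1 (- a) by rewrite -scaleN1r; apply: homogZ.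
have lNa : wlinear (- a).
  by move=> s k x y r; rewrite !wformNE la; ring.
have Bw : contract B w = - a by apply: contract_sharp.
have bA : b [:: A] = 0 by rewrite -Aw /contract antisym_diag.
have aB : a [:: B] = 0.
  by apply: oppr_inj; rewrite -wformNE -Bw /contract antisym_diag// oppr0.
have bB : b [:: B] = a [:: A].
  rewrite -Aw -[a in RHS]opprK -Bw wformNE /contract.
  exact: (aw [::] A B [::]).
have Ae : contract A e = (1 - a [:: A]) *: b.
  have : contract A e + contract A (a * b) = b by rewrite -contractD.
  rewrite contract_wedge11// bA scale0r subr0 => E.
  by rewrite scalerBl scale1r; apply: (canRL (addrK _)) E.
have aA : a [:: A] = 1.
  apply/eqP; rewrite eq_sym -subr_eq0; apply/negPn/negP => c0; apply: vol.
  have ek : ~~ odd (h * 2) by rewrite muln2 odd_double.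
  rewrite -mulrA (homog_commr ek (homogX he) hb).
  suff -> : b * e ^+ h = 0 by rewrite mulr0.
  apply: (@scalerI R _ (h.+1%:R * (1 - a [:: A]))).
    by rewrite mulf_neq0// pnatr_eq0.
  by rewrite scaler0 -scalerA -wformZl -Ae -contract_exp// eh.
split=> //; last by rewrite bB.
rewrite Ae aA subrr scale0r; split=> //.
have : contract B e + contract B (a * b) = - a by rewrite -contractD.
by rewrite contract_wedge11// aB bB aA scale0r add0r scale1r => /(canRL (addrK _)) ->;
  rewrite opprK addNr.
Qed.

(** The vector [L] that [w] pairs to [t] lies in the kernel of [e = w - a * t],
    which makes [e ^+ h.+1] vanish; the top power of [w] is then a multiple of
    [a * e ^+ h * t], and it is non-zero as [w] is non-degenerate. *)
Lemma lcs_algebra h w t X : n = h.*2.+2 ->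
  homog 2 w -> antisym w -> wlinear w -> nondegenerate_word w ->
  homog 1 t -> wlinear t -> t [:: X] = 1 ->
  let a := - contract X w in let e := w - a * t in
  e ^+ h.+1 = 0 /\ a * e ^+ h * t <> 0.
Proof.
move=> nh hw aw lw nw ht lt tX a e.
have ha : homog 1 a by rewrite /a -scaleN1r; apply: homogZ; apply: homog_contract hw.
have la : wlinear a.
  by move=> s k x y r; rewrite /a !wformNE (wlinear_contract X lw); ring.
pose L := sharp w t.
have Lw : contract L w = t by apply: contract_sharp.
have tL : t [:: L] = 0 by rewrite -Lw /contract antisym_diag.
have aL : a [:: L] = 1.
  rewrite -tX -[t in RHS]Lw /a wformNE /contract.
  by rewrite [w [:: X; L]](aw [::]) opprK.
have we : w = e + a * t by rewrite /e subrK.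
have hat : homog 2 (a * t) by apply: (homogM ha ht).
have he : homog 2 e by rewrite /e -scaleN1r; apply/homogD/homogZ.
have ae : antisym e.
  move=> s x y r; rewrite /e !wformDE !wformNE aw.
  by rewrite (antisymM (antisym_homog1 ha) (antisym_homog1 ht)) opprD.
have le : wlinear e.
  by move=> s k x y r; rewrite /e !wformDE !wformNE lw (wlinearM la lt); ring.
have eh : e ^+ h.+1 = 0.
  apply: (@top_power_degenerate _ L) => //; first by rewrite mulSn muln2 nh.
    apply/eqP => L0; have := tX; rewrite -Lw L0.
    have -> : contract 0 w = 0.
      by apply/funext => s; apply: (wlinear0 [::] s lw).
    by move=> /eqP; rewrite eq_sym oner_eq0.
  rewrite /e contractD contractN contract_wedge11// Lw aL tL.
  by rewrite scale1r scale0r subr0 subrr.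
split=> // vol; apply: (@power_nondegenerate w h.+1) => //.
  by rewrite mulSn muln2 nh.
by rewrite we exp_plus_product// eh vol scaler0 addr0.
Qed.

(** Contracting [t * w = 0] with a vector [Y] such that [t Y = 1] gives
    [w = t * g] with [g] the contraction of [w].  In dimension at least three
    some non-zero vector is killed by both [t] and [g], hence lies in the kernel
    of [w]. *)
Lemma nondegenerate_mul_eq0 w t : (2 < n)%N -> homog 2 w -> wlinear w ->
  nondegenerate_word w -> homog 1 t -> wlinear t -> w * t = 0 -> t = 0.
Proof.
move=> n2 hw lw nw ht lt wt; apply: contrapT => t0.
have [Y tY] : exists Y, t [:: Y] = 1.
  apply: contrapT => nY; apply: t0; apply: (homog_eq0 ht) => -[|x [|? ?]]// _.
  apply/eqP/negPn/negP => tx; apply: nY; exists ((t [:: x])^-1 *: x).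
  by rewrite (wlinearZ [::] _ _ [::] lt)/= mulVf.
pose g := contract Y w.
have hg : homog 1 g by apply: homog_contract hw.
have lg : wlinear g by apply: wlinear_contract.
have wE : w = t * g.
  have := congr1 (contract Y) wt.
  rewrite (homog_commr (k := 2) _ hw ht)// contractM contract_homog1// tY scale1r mul1r.
  by rewrite (homog_parity ht) scaleN1r mulNr contract0 => /eqP; rewrite subr_eq0 => /eqP.
(* two equations in more than two unknowns *)
have [u u0 uK] := exists_kernel (row_mx (covector t)^T (covector g)^T) n2.
move: uK; rewrite mul_mx_row -[0]hsubmxK => /eq_row_mx[ut ug].
have ut0 : t [:: u] = 0 by rewrite covectorE// ut !mxE.
have ug0 : g [:: u] = 0 by rewrite covectorE// ug !mxE.
move/eqP: u0; apply; apply: nw.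
by rewrite wE contract_wedge11// ut0 ug0 !scale0r subrr.
Qed.

End LinearAlgebra.

(** * Differentiability and the symmetry of second derivatives *)

Section Differentials.
Context {R : realType} {V W : normedModType R}.

Lemma differentiable_expansion (f : V -> W) (x : V) (df : {linear V -> W}) :
  continuous df ->
  (forall e : R, 0 < e ->
     \forall h \near (0 : V), `|f (h + x) - (f x + df h)| <= e * `|h|) ->
  differentiable f x.
Proof.
move=> dfc fe.
have E : f \o shift x = cst (f x) + df +o_ (0 : V) id.
  by apply/eqaddoP => e e0; apply: fe.
by apply/diff_locallyP; rewrite (diff_unique dfc E).
Qed.

(** The difference of the two functions vanishes near [x], hence is differentiable
    there. *)
Lemma near_eq_differentiable (f g : V -> W) (x : V) :
  {near x, f =1 g} -> differentiable f x -> differentiable g x.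
Proof.
move=> fg df; have h0 : differentiable (g - f) x.
  pose z : {linear V -> W} := \0.
  apply: (@differentiable_expansion _ _ z) => [|e e0]; first exact: cst_continuous.
  have := fg; rewrite (near_shift 0 x) /= subr0 => fg0.
  have gfx : (g - f) x = 0.
    by rewrite !fctE (nbhs_singleton fg) subrr.
  near=> h; rewrite gfx /= addr0 subr0 !fctE.
  have -> : f (h + x) = g (h + x) by near: h.
  by rewrite subrr normr0 mulr_ge0// ltW.
have -> : g = f + (g - f) by apply/funext => y; rewrite !fctE addrC subrK.
exact: differentiableD.
Unshelve. all: by end_near. Qed.

End Differentials.

Section DirectionalDerivatives.
Context {R : realType} {V : normedModType R}.

Lemma is_derive_line (f : V -> R) (y u : V) (s : R) :
  differentiable f (y + s *: u) ->
  is_derive s (1 : R) (fun t => f (y + t *: u)) ('D_u f (y + s *: u)).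
Proof.
move=> df; have dl : is_diff s (fun t : R => y + t *: u) (fun t => t *: u).
  have l := @is_diff_scalel R V s u.
  have c : is_diff s (cst y) (0 : R^o -> V) by apply: is_diff_cst.
  by apply: is_diff_eq (is_diffD c l) _; apply/funext => t; rewrite !fctE add0r.
have dc : is_diff s (f \o (fun t => y + t *: u))
    ('d f (y + s *: u) \o (fun t => t *: u)).
  by apply: is_diff_comp; apply: differentiableP.
apply: DeriveDef; first exact/diff_derivable/ex_diff.
by rewrite deriveE// diff_val /= scale1r deriveE.
Qed.

(** The mean value theorem for [s |-> f (x + t v + s u) - f (x + s u)] on [0, t]
    writes the second difference as [t] times a difference of values of [D_u f],
    which the differentiability of [D_u f] at [x] evaluates up to [o(t)]. *)
Lemma second_difference (f : V -> R) (x u v : V) :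
  (\forall y \near x, differentiable f y) -> differentiable ('D_u f) x ->
  forall e : R, 0 < e -> \forall t \near (0 : R)^'+,
   `|f (x + t *: u + t *: v) - f (x + t *: u) - f (x + t *: v) + f x
     - t ^+ 2 * 'D_v ('D_u f) x| <= e * t ^+ 2.
Proof.
(* [N t] bounds the norm of [q v + s u] for [s] and [q] in [0, t]; the summand 1
   keeps it positive *)
move=> df dg e e0; set g := 'D_u f; set N := `|u| + `|v| + 1.
have N0 : 0 < N by rewrite ltr_wpDl// addr_ge0.
have e1 : 0 < e / (2 * N) by rewrite divr_gt0// mulr_gt0.
have : \forall h \near (0 : V), differentiable f (h + x) /\
     `|g (h + x) - (g x + 'd g x h)| <= e / (2 * N) * `|h|.
  near=> h; split.
    by near: h; move: df; rewrite (near_shift 0 x) /= subr0.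
  near: h; have /diff_locally/eqaddoP := dg; exact.
case/nbhs_normP => r /= r0 Hr.
near=> t.
have t0 : 0 < t by [].
have tN : t * N < r by rewrite -ltr_pdivlMr//; near: t; exact: nbhs_right_lt (divr_gt0 r0 N0).
have Hs s q : 0 <= s <= t -> 0 <= q <= t ->
   [/\ differentiable f (x + q *: v + s *: u) &
      `|g (x + q *: v + s *: u) - (g x + 'd g x (q *: v + s *: u))| <= e / 2 * t].
  move=> /andP[s0 st] /andP[q0 qt].
  have hN : `|q *: v + s *: u| <= t * N.
    rewrite (le_trans (ler_normD _ _))// !normrZ !ger0_norm//.
    rewrite /N !mulrDr mulr1 addrC.
    have := ler_wpM2r (normr_ge0 u) st; have := ler_wpM2r (normr_ge0 v) qt.
    by lra.
  have /Hr [] : `|0 - (q *: v + s *: u)| < r.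
    by rewrite sub0r normrN (le_lt_trans hN).
  have -> : q *: v + s *: u + x = x + q *: v + s *: u by rewrite addrC addrA.
  move=> d1 d2; split=> //; apply: le_trans d2 _.
  have -> : e / 2 * t = e / (2 * N) * (t * N) by field; rewrite gt_eqF.
  by rewrite ler_wpM2l// ltW.
pose phi s := f (x + t *: v + s *: u) - f (x + s *: u).
have tt : 0 <= t <= t by rewrite lexx ltW.
have z0 : 0 <= (0 : R) <= t by rewrite lexx ltW.
have Hs0 s : 0 <= s <= t -> [/\ differentiable f (x + s *: u) &
      `|g (x + s *: u) - (g x + 'd g x (s *: u))| <= e / 2 * t].
  by move=> /Hs /(_ z0); rewrite scale0r addr0 add0r.
have dphi s : 0 <= s <= t ->
   is_derive s 1 phi (g (x + t *: v + s *: u) - g (x + s *: u)).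
  move=> st; have [d1 _] := Hs _ _ st tt; have [d2 _] := Hs0 _ st.
  by apply: is_deriveB; apply: is_derive_line.
have [c] : exists2 c, c \in `]0, t[%R &
    phi t - phi 0 = (g (x + t *: v + c *: u) - g (x + c *: u)) * (t - 0).
  apply: MVT => //.
    by move=> s; rewrite in_itv /= => /andP[s0 st]; apply: dphi; rewrite !ltW.
  apply: derivable_within_continuous => s; rewrite in_itv /= => st.
  exact: (ex_derive (is_derive := dphi s st)).
rewrite in_itv /= subr0 /phi scale0r !addr0 => /andP[c0 ct] E.
have cc : 0 <= c <= t by rewrite !ltW.
have [_ B1] := Hs _ _ cc tt; have [_ B2] := Hs0 _ cc.
have -> : f (x + t *: u + t *: v) - f (x + t *: u) - f (x + t *: v) + f x =
   (g (x + t *: v + c *: u) - g (x + c *: u)) * t.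
  by rewrite -E [x + t *: u + t *: v]addrAC; ring.
rewrite (deriveE v dg) -/g expr2.
have L1 : 'd g x (t *: v + c *: u) = t * 'd g x v + c * 'd g x u.
  by rewrite linearD !linearZ.
have L2 : 'd g x (c *: u) = c * 'd g x u by rewrite linearZ.
move: B1 B2; rewrite L1 L2.
move: (g (x + t *: v + c *: u)) (g (x + c *: u)) (g x) ('d g x v) ('d g x u).
move=> g1 g2 g0 a b.
rewrite !ler_norml => /andP[B1 B1'] /andP[B2 B2'].
have -> : (g1 - g2) * t - t * t * a = (g1 - g2 - t * a) * t by ring.
rewrite [e * _]mulrA -mulNr !ler_pM2r//.
by move: B1 B1' B2 B2'; set X := t * a; set Y := c * b; lra.
Unshelve. all: by end_near. Qed.

(** Young's form of the symmetry of second derivatives: the second difference of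
    [second_difference] is symmetric in [u] and [v]. *)
Lemma derive_comm (f : V -> R) (x u v : V) :
  (\forall y \near x, differentiable f y) ->
  differentiable ('D_u f) x -> differentiable ('D_v f) x ->
  'D_v ('D_u f) x = 'D_u ('D_v f) x.
Proof.
move=> df du dv; apply/eqP; rewrite -subr_eq0 -normr_le0.
apply/ler_addgt0Pl => e e0; rewrite addr0.
have e2 : 0 < e / 2 by rewrite divr_gt0.
have H1 := second_difference v df du e2.
have H2 := second_difference u df dv e2.
have : \forall t \near (0 : R)^'+, `|'D_v ('D_u f) x - 'D_u ('D_v f) x| <= e.
  have H3 : \forall t \near (0 : R)^'+, 0 < t by near=> t.
  apply: filterS3 H1 H2 H3 => t B1 B2 t0.
  have t2 : 0 < t ^+ 2 by rewrite exprn_gt0.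
  rewrite -(ler_pM2r t2) -[t ^+ 2 in leLHS]gtr0_norm// -normrM.
  move: B1 B2; have -> : x + t *: v + t *: u = x + t *: u + t *: v by rewrite addrAC.
  set a := 'D_v ('D_u f) x; set b := 'D_u ('D_v f) x; set T := t ^+ 2.
  set p := f (x + t *: u + t *: v); set q := f (x + t *: u).
  set r := f (x + t *: v); set s := f x; clearbody a b T p q r s.
  rewrite !ler_norml.
  by move=> /andP[? ?] /andP[? ?]; apply/andP; split; lra.
by case/filter_ex.
Unshelve. all: by end_near. Qed.

End DirectionalDerivatives.

(** * Smooth functions *)

Section SmoothFunctions.
Context {R : realType} {n : nat}.
Local Notation V := 'rV[R]_n.
Implicit Types (U : set V) (f g : V -> R).

(** The functions are total while smoothness concerns [U] only, so functions that
    agree on [U] have to be exchanged after each differentiation. *)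
Lemma Ck_on_congr k U f g : open U -> (forall x, U x -> f x = g x) ->
  Ck_on k U f -> Ck_on k U g.
Proof.
move=> oU; elim: k f g => [|k IH] f g fg.
  move=> cf x Ux; change (g @ x --> g x); rewrite -(fg x Ux).
  have nfg : \forall y \near x, f y = g y.
    have : \forall y \near x, U y by apply: open_nbhs_nbhs.
    by apply: filterS => y Uy; rewrite fg.
  by apply: cvg_trans (cf x Ux); apply: (near_eq_cvg nfg).
have nfg x : U x -> {near x, f =1 g}.
  move=> Ux; have : \forall y \near x, U y by apply: open_nbhs_nbhs.
  by apply: filterS => y Uy; rewrite /= fg.
case=> df Df; split=> [x Ux|i].
  by apply: (near_eq_differentiable (nfg _ Ux)); apply: df.
apply: IH (Df i) => x Ux; exact: near_eq_derive (nfg _ Ux).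
Qed.

Lemma Ck_onS k U f : Ck_on k.+1 U f -> Ck_on k U f.
Proof.
elim: k f => [|k IH] f [df Df].
  by move=> x /df/differentiable_continuous.
by split=> // i; apply: IH.
Qed.

Lemma Ck_on_cst k U (c : R) : Ck_on k U (fun=> c).
Proof.
elim: k c => [|k IH] c; first by move=> x _; exact: cst_continuous.
split=> [x _|i]; first exact: differentiable_cst.
have -> : (fun x => 'D_(delta_mx 0 i) (fun=> c) x) = (fun=> 0) :> (V -> R).
  by apply/funext => x; rewrite derive_cst.
exact: IH.
Qed.

Lemma Ck_onD k U f g : open U -> Ck_on k U f -> Ck_on k U g ->
  Ck_on k U (fun x => f x + g x).
Proof.
move=> oU; elim: k f g => [|k IH] f g.
  by move=> cf cg x Ux; apply: continuousD; [exact: cf|exact: cg].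
move=> [df Df] [dg Dg]; split=> [x Ux|i].
  by apply: differentiableD; [exact: df|exact: dg].
apply: Ck_on_congr (IH _ _ (Df i) (Dg i)) => // x Ux.
by rewrite -deriveD//; apply: diff_derivable; [exact: df|exact: dg].
Qed.

Lemma Ck_onM k U f g : open U -> Ck_on k U f -> Ck_on k U g ->
  Ck_on k U (fun x => f x * g x).
Proof.
move=> oU; elim: k f g => [|k IH] f g.
  by move=> cf cg x Ux; apply: continuousM; [exact: cf|exact: cg].
move=> Cf Cg; have [df Df] := Cf; have [dg Dg] := Cg; split=> [x Ux|i].
  by apply: differentiableM; [exact: df|exact: dg].
have H := Ck_onD oU (IH _ _ (Ck_onS Cf) (Dg i)) (IH _ _ (Ck_onS Cg) (Df i)).
apply: Ck_on_congr H => // x Ux.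
by rewrite -[RHS]/('D_(delta_mx 0 i) (f * g) x) deriveM//; apply: diff_derivable;
  [exact: df|exact: dg].
Qed.

Lemma Ck_onV k U f : open U -> (forall x, U x -> f x != 0) -> Ck_on k U f ->
  Ck_on k U (fun x => (f x)^-1).
Proof.
move=> oU f0; elim: k => [|k IH].
  by move=> cf x Ux; apply: continuousV; [exact: f0|exact: cf].
move=> Cf; have [df Df] := Cf; split=> [x Ux|i].
  by apply: differentiableV; [exact: df|exact: f0].
have Cv := IH (Ck_onS Cf).
have H := Ck_onM oU (Ck_on_cst k U (-1)) (Ck_onM oU (Ck_onM oU Cv Cv) (Df i)).
apply: Ck_on_congr H => // x Ux.
rewrite [RHS]deriveV ?f0//; last exact/diff_derivable/df.
by rewrite mulN1r /GRing.scale /= mulNr -invfM -expr2.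
Qed.

(** The coinductive reading of smoothness. *)
Lemma smooth_onP U f : smooth_on U f <->
  (forall x, U x -> differentiable f x) /\
  (forall i : 'I_n, smooth_on U ('D_(delta_mx 0 i) f)).
Proof.
split=> [sf|[df sf] k].
  by split=> [|i k]; [have [] := sf 1%N|have [_ Df] := sf k.+1; apply: Df].
by apply: Ck_onS; split=> // i; apply: sf.
Qed.

Lemma smooth_on_differentiable U f x : smooth_on U f -> U x -> differentiable f x.
Proof. by move=> /smooth_onP[df _]; apply: df. Qed.

Lemma smooth_on_congr U f g : open U -> (forall x, U x -> f x = g x) ->
  smooth_on U f -> smooth_on U g.
Proof. by move=> oU fg sf k; apply: Ck_on_congr (sf k). Qed.

Lemma smooth_on_cst U (c : R) : smooth_on U (fun=> c).
Proof. by move=> k; apply: Ck_on_cst. Qed.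

Lemma smooth_onD U f g : open U -> smooth_on U f -> smooth_on U g ->
  smooth_on U (fun x => f x + g x).
Proof. by move=> oU sf sg k; apply: Ck_onD. Qed.

Lemma smooth_onM U f g : open U -> smooth_on U f -> smooth_on U g ->
  smooth_on U (fun x => f x * g x).
Proof. by move=> oU sf sg k; apply: Ck_onM. Qed.

Lemma smooth_onZ U (c : R) f : open U -> smooth_on U f ->
  smooth_on U (fun x => c * f x).
Proof. by move=> oU; apply: smooth_onM => //; apply: smooth_on_cst. Qed.

Lemma smooth_onN U f : open U -> smooth_on U f -> smooth_on U (fun x => - f x).
Proof.
move=> oU sf; apply: smooth_on_congr (smooth_onZ (-1) oU sf) => // x _.
by rewrite mulN1r.
Qed.

Lemma smooth_onB U f g : open U -> smooth_on U f -> smooth_on U g ->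
  smooth_on U (fun x => f x - g x).
Proof. by move=> oU sf sg; apply: smooth_onD => //; apply: smooth_onN. Qed.

Lemma smooth_onV U f : open U -> (forall x, U x -> f x != 0) -> smooth_on U f ->
  smooth_on U (fun x => (f x)^-1).
Proof. by move=> oU f0 sf k; apply: Ck_onV. Qed.

Lemma smooth_on_sum U (I : Type) (r : seq I) (P : pred I) (F : I -> V -> R) :
  open U -> (forall i, smooth_on U (F i)) ->
  smooth_on U (fun x => \sum_(i <- r | P i) F i x).
Proof.
move=> oU sF; elim: r => [|i r IH].
  by apply: smooth_on_congr (smooth_on_cst U 0) => // x _; rewrite big_nil.
case Pi : (P i).
  by apply: smooth_on_congr (smooth_onD oU (sF i) IH) => // x _; rewrite big_cons Pi.
by apply: smooth_on_congr IH => // x _; rewrite big_cons Pi.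
Qed.

Lemma smooth_on_prod U (I : Type) (r : seq I) (F : I -> V -> R) :
  open U -> (forall i, smooth_on U (F i)) ->
  smooth_on U (fun x => \prod_(i <- r) F i x).
Proof.
move=> oU sF; elim: r => [|i r IH].
  by apply: smooth_on_congr (smooth_on_cst U 1) => // x _; rewrite big_nil.
by apply: smooth_on_congr (smooth_onM oU (sF i) IH) => // x _; rewrite big_cons.
Qed.

Lemma smooth_on_det U m (A : V -> 'M[R]_m) : open U ->
  (forall i j, smooth_on U (fun x => A x i j)) -> smooth_on U (fun x => \det (A x)).
Proof.
move=> oU sA; apply: smooth_on_sum => // s; apply: smooth_onZ => //.
by apply: smooth_on_prod => // i; apply: sA.
Qed.

Lemma smooth_on_invmx U m (A : V -> 'M[R]_m) i j : open U ->
  (forall x, U x -> A x \in unitmx) ->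
  (forall i j, smooth_on U (fun x => A x i j)) ->
  smooth_on U (fun x => invmx (A x) i j).
Proof.
move=> oU uA sA.
have sd : smooth_on U (fun x => (\det (A x))^-1).
  apply: smooth_onV => //; last exact: smooth_on_det.
  by move=> x /uA; rewrite unitmxE unitfE.
have sc : smooth_on U (fun x => cofactor (A x) j i).
  apply: smooth_onZ => //; apply: smooth_on_det => // k l.
  apply: smooth_on_congr (sA (lift j k) (lift i l)) => // x _.
  by rewrite !mxE.
apply: smooth_on_congr (smooth_onM oU sd sc) => // x Ux.
by rewrite /invmx uA// !mxE.
Qed.

Lemma derive_linear f x (c : R) u v : differentiable f x ->
  'D_(c *: u + v) f x = c * 'D_u f x + 'D_v f x.
Proof. by move=> df; rewrite !deriveE// linearP. Qed.

Lemma derive_sum_delta f x u : differentiable f x ->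
  'D_u f x = \sum_i u 0 i * 'D_(delta_mx 0 i) f x.
Proof.
move=> df; rewrite deriveE// [in LHS](row_sum_delta u) linear_sum.
by apply: eq_bigr => i _; rewrite linearZ deriveE.
Qed.

Lemma smooth_on_derive U f u : open U -> smooth_on U f -> smooth_on U ('D_u f).
Proof.
move=> oU sf; have [df Df] := (smooth_onP _ _).1 sf.
have H : smooth_on U (fun x => \sum_i u 0 i * 'D_(delta_mx 0 i) f x).
  by apply: smooth_on_sum => // i; apply: smooth_onZ.
by apply: smooth_on_congr H => // x /df dfx; rewrite -derive_sum_delta.
Qed.

Lemma smooth_on_derive_comm U f u v x : open U -> smooth_on U f -> U x ->
  'D_v ('D_u f) x = 'D_u ('D_v f) x.
Proof.
move=> oU sf Ux; apply: derive_comm.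
- have nU : \forall y \near x, U y by apply: open_nbhs_nbhs.
  by apply: filterS nU => y Uy; apply: smooth_on_differentiable sf Uy.
- exact: smooth_on_differentiable (smooth_on_derive u oU sf) Ux.
- exact: smooth_on_differentiable (smooth_on_derive v oU sf) Ux.
Qed.

End SmoothFunctions.

(** * Jacobian matrices and the chain rule *)

Section Jacobians.
Context {R : realType}.

(** Reassembles a map from its coordinates, since smoothness of maps is stated
    coordinatewise. *)
Lemma differentiable_row n m (phi : 'rV[R]_n -> 'rV[R]_m) x :
  (forall j, differentiable (fun y => phi y 0 j) x) -> differentiable phi x.
Proof.
move=> dphi.
have -> : phi = \sum_(j < m) (fun y => phi y 0 j *: (delta_mx 0 j : 'rV[R]_m)).
  by apply/funext => y; rewrite [LHS]row_sum_delta fct_sumE.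
by apply: differentiable_sum => j; apply: differentiableZl.
Qed.

Lemma mul_jacobian n m (phi : 'rV[R]_n -> 'rV[R]_m) x v : differentiable phi x ->
  v *m 'J phi x = 'D_v phi x.
Proof. by move=> dphi; rewrite deriveEjacobian. Qed.

Lemma derive_row n m (phi : 'rV[R]_n -> 'rV[R]_m) x v j : differentiable phi x ->
  ('D_v phi x) 0 j = 'D_v (fun y => phi y 0 j) x.
Proof. by move=> dphi; rewrite derive_mx ?mxE//; apply: diff_derivable. Qed.

Lemma derive_comp n m (phi : 'rV[R]_n -> 'rV[R]_m) (f : 'rV[R]_m -> R) x v :
  differentiable phi x -> differentiable f (phi x) ->
  'D_v (fun y => f (phi y)) x = 'D_(v *m 'J phi x) f (phi x).
Proof.
move=> dphi df; rewrite mul_jacobian// deriveE; last exact: differentiable_comp.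
by rewrite diff_comp//= [in RHS]deriveE// deriveE.
Qed.

Lemma eq_mulmx_left n m (A B : 'M[R]_(n, m)) :
  (forall v : 'rV[R]_n, v *m A = v *m B) -> A = B.
Proof. by move=> AB; apply/row_matrixP => i; rewrite !rowE. Qed.

Lemma jacobian_comp n m k (phi : 'rV[R]_n -> 'rV[R]_m) (psi : 'rV[R]_m -> 'rV[R]_k) x :
  differentiable phi x -> differentiable psi (phi x) ->
  'J (psi \o phi) x = 'J phi x *m 'J psi (phi x).
Proof.
move=> dphi dpsi; have dc := differentiable_comp dphi dpsi.
apply: eq_mulmx_left => v; rewrite mulmxA.
apply: etrans (mul_jacobian v dc) _.
rewrite (mul_jacobian v dphi); apply: etrans _ (esym (mul_jacobian _ dpsi)).
by rewrite (deriveE _ dc) (deriveE _ dphi) (deriveE _ dpsi) (diff_comp dphi dpsi).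
Qed.

Lemma near_eq_jacobian n m (phi psi : 'rV[R]_n -> 'rV[R]_m) x :
  {near x, phi =1 psi} -> differentiable phi x -> 'J phi x = 'J psi x.
Proof.
move=> pp dphi; have dpsi := near_eq_differentiable pp dphi.
apply: eq_mulmx_left => v; apply: etrans (mul_jacobian v dphi) _.
by apply: etrans (near_eq_derive v pp) (esym (mul_jacobian v dpsi)).
Qed.

Lemma jacobian_id n (x : 'rV[R]_n) : 'J (id : 'rV[R]_n -> 'rV[R]_n) x = 1%:M.
Proof.
have did : differentiable (id : 'rV[R]_n -> 'rV[R]_n) x by exact: ex_diff.
apply: eq_mulmx_left => v; apply: etrans (mul_jacobian v did) _.
by rewrite derive_id mulmx1.
Qed.

End Jacobians.

(** * Transition maps *)

Section Charts.
Context {R : realType} {n : nat} {M : smoothManifold R n}.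
Implicit Types (c : chart R n M) (p : M).
Local Notation V := 'rV[R]_n.

Lemma cimgP c x : cimg c x -> cdom c (cinv c x) /\ cto c (cinv c x) = x.
Proof. by case=> p cp <-; rewrite ctoK. Qed.

Lemma cimg_cto c p : cdom c p -> cimg c (cto c p).
Proof. by exists p. Qed.

(** The part of the image of [c] on which the change of coordinates to [c'] is
    meaningful. *)
Definition overlap c c' : set V := cto c @` (cdom c `&` cdom c').
Definition transition c c' : V -> V := cto c' \o cinv c.
Definition transition_mx c c' p : 'M[R]_n := 'J (transition c c') (cto c p).

Lemma near_overlap c c' p : cdom c p -> cdom c' p ->
  \forall y \near cto c p, overlap c c' y.
Proof.
move=> cp c'p.
have cx := cimg_cto cp.
have n1 : \forall y \near cto c p, cimg c y.
  by apply: open_nbhs_nbhs; split => //; apply: cimg_open.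
have n2 : \forall y \near cto c p, cdom c' (cinv c y).
  have cc := cinv_continuous cx.
  have : nbhs (cinv c (cto c p)) (cdom c').
    by rewrite ctoK//; apply: open_nbhs_nbhs; split => //; apply: cdom_open.
  exact: cc.
apply: filterS2 n1 n2 => y /cimgP[d1 d2] d3.
by exists (cinv c y).
Qed.

Lemma overlap_open c c' : open (overlap c c').
Proof.
rewrite openE => x [p [cp c'p] <-]; exact: near_overlap.
Qed.

Lemma transition_differentiable c c' p : atlas c -> atlas c' ->
  cdom c p -> cdom c' p -> differentiable (transition c c') (cto c p).
Proof.
move=> ac ac' cp c'p; apply: differentiable_row => j.
apply: smooth_on_differentiable (transition_smooth ac ac' j) _.
by exists p.
Qed.

Lemma transitionE c c' p : cdom c p -> transition c c' (cto c p) = cto c' p.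
Proof. by move=> cp; rewrite /transition /= ctoK. Qed.

(** The chain rule for [transition c c''], which agrees with
    [transition c' c'' \o transition c c'] near [cto c p]. *)
Lemma transition_mxM c c' c'' p : atlas c -> atlas c' -> atlas c'' ->
  cdom c p -> cdom c' p -> cdom c'' p ->
  transition_mx c c'' p = transition_mx c c' p *m transition_mx c' c'' p.
Proof.
move=> ac ac' ac'' cp c'p c''p; rewrite /transition_mx.
have d1 := transition_differentiable ac ac' cp c'p.
have d2 : differentiable (transition c' c'') (transition c c' (cto c p)).
  by rewrite transitionE//; apply: transition_differentiable.
have E := congr1 (fun y => 'J (transition c c') (cto c p) *m 'J (transition c' c'') y)
  (transitionE c' cp).
apply: etrans _ E; apply: etrans _ (jacobian_comp d1 d2).
apply: near_eq_jacobian; last exact: transition_differentiable.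
apply: filterS (near_overlap cp c'p) => y [q [cq c'q] <-].
by rewrite /= transitionE// transitionE// transitionE.
Qed.

Lemma transition_mx_id c p : atlas c -> cdom c p -> transition_mx c c p = 1%:M.
Proof.
move=> ac cp; rewrite -(jacobian_id (cto c p)); apply: near_eq_jacobian.
  by apply: filterS (near_overlap cp cp) => y [q [cq _] <-]; rewrite transitionE.
exact: transition_differentiable.
Qed.

Lemma transition_mxK c c' p : atlas c -> atlas c' -> cdom c p -> cdom c' p ->
  transition_mx c c' p *m transition_mx c' c p = 1%:M.
Proof. by move=> *; rewrite -transition_mxM// transition_mx_id. Qed.

Lemma vrepE c (X : vfield M) p : cdom c p ->
  vrep c X (cto c p) = X p *m transition_mx (chart_at p) c p.
Proof. by move=> cp; rewrite /vrep ctoK. Qed.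

Lemma frepE c k (a : kform M k) p v : cdom c p ->
  frep c a (cto c p) v = a p (v *m transition_mx c (chart_at p) p).
Proof. by move=> cp; rewrite /frep ctoK. Qed.

Lemma chart_at_vrep (X : vfield M) p :
  vrep (chart_at p) X (cto (chart_at p) p) = X p.
Proof.
rewrite (vrepE X (chart_at_dom p)).
by rewrite (transition_mx_id (chart_at_atlas p) (chart_at_dom p)) mulmx1.
Qed.

Lemma chart_at_frep k (a : kform M k) p :
  frep (chart_at p) a (cto (chart_at p) p) = a p.
Proof.
apply/funext => v; rewrite (frepE a v (chart_at_dom p)).
by rewrite (transition_mx_id (chart_at_atlas p) (chart_at_dom p)) mulmx1.
Qed.

Lemma vrepK c (X : vfield M) p : atlas c -> cdom c p ->
  vrep c X (cto c p) *m transition_mx c (chart_at p) p = X p.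
Proof.
move=> ac cp; rewrite (vrepE X cp) -mulmxA.
by rewrite (transition_mxK (chart_at_atlas p) ac (chart_at_dom p) cp) mulmx1.
Qed.

(** The representation in one chart determines the one in any other by the
    Jacobian of the change of coordinates. *)
Lemma frep_transition c c' k (a : kform M k) p v : atlas c -> atlas c' ->
  cdom c p -> cdom c' p ->
  frep c a (cto c p) v = frep c' a (cto c' p) (v *m transition_mx c c' p).
Proof.
move=> ac ac' cp c'p; rewrite (frepE a _ cp) (frepE a _ c'p) -mulmxA.
by rewrite -(transition_mxM ac ac' (chart_at_atlas p) cp c'p (chart_at_dom p)).
Qed.

End Charts.

(** * Pullback of words *)

Section Pullback.
Context {R : realType} {n : nat}.
Local Notation V := 'rV[R]_n.
Local Notation wform := (@wform R V).
Implicit Types (a b : wform) (g : V -> V).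

Definition pullback g a : wform := fun s => a (map g s).

Lemma pullbackM g a b : pullback g (a * b) = pullback g a * pullback g b.
Proof.
apply/funext => s; elim: s a b => [|v s IH] a b //.
rewrite {1}/pullback /= -!/(contract _ _ _) !contractM !wformDE.
have C d : contract v (pullback g d) = pullback g (contract (g v) d) by [].
have P d : parity (pullback g d) = pullback g (parity d).
  by apply/funext => w; rewrite /parity /pullback size_map.
by rewrite !C P -!IH.
Qed.

Lemma antisym_pullback g a : antisym a -> antisym (pullback g a).
Proof. by move=> aa s x y r; rewrite /pullback !map_cat /= aa. Qed.

Lemma wlinear_pullback (J : 'M[R]_n) a : wlinear a -> wlinear (pullback (mulmxr J) a).
Proof.
move=> la s k x y r; rewrite /pullback !map_cat /=.
by rewrite mulmxDl -scalemxAl la.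
Qed.

Lemma words_pullback k (f : 'M[R]_(k, n) -> R) (J : 'M[R]_n) :
  words (fun v => f (v *m J)) = pullback (mulmxr J) (words f).
Proof.
apply/funext => s; rewrite /words /pullback size_map; case: eqP => // sk.
congr f; apply/row_matrixP => i; rewrite row_mul !rowK (nth_map 0)//.
by rewrite sk.
Qed.

Lemma nth_mx_rows k (v : 'M[R]_(k, n)) (i : 'I_k) : nth 0 (mx_rows v) i = row i v.
Proof. by rewrite (nth_map i) ?size_enum_ord// nth_ord_enum. Qed.

Lemma multilinear_words k (f : 'M[R]_(k, n) -> R) :
  wlinear (words f) -> multilinear f.
Proof.
move=> lf i c x y v.
have E z : f (set_row i z v) =
    words f (take i (mx_rows v) ++ z :: drop i.+1 (mx_rows v)).
  rewrite -words_rows; congr (words f _).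
  have sz : size (mx_rows v) = k by rewrite size_map size_enum_ord.
  have iz : (i < size (mx_rows v))%N by rewrite sz.
  apply: (@eq_from_nth _ 0) => [|j].
    by rewrite size_map size_enum_ord size_cat /= size_takel ?(ltnW iz)// size_drop
      sz addnS -addSn subnKC.
  rewrite size_map size_enum_ord => jk.
  rewrite -[j]/(val (Ordinal jk)) (nth_map (Ordinal jk)) ?size_enum_ord//.
  rewrite nth_ord_enum rowK nth_cat size_takel ?(ltnW iz)//.
  have [->|ji] := eqVneq (Ordinal jk) i; first by rewrite ltnn subnn.
  rewrite -nth_mx_rows /=.
  case: ltnP => ij; first by rewrite nth_take.
  have {}ij : (i < j)%N.
    by rewrite ltn_neqAle ij andbT eq_sym; apply: contraNneq ji => e; apply/eqP/val_inj.
  by rewrite -[(j - i)%N]prednK ?subn_gt0//= nth_drop -subnS subnKC.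
by rewrite !E lf.
Qed.

Lemma alternating_words k (f : 'M[R]_(k, n) -> R) :
  antisym (words f) -> Defs.alternating f.
Proof.
move=> af v i j; wlog ij : i j / (i < j)%N => [H ij|_ E].
  case: (ltngtP i j) => [l|l|/val_inj e]; [exact: H| |by rewrite e eqxx in ij].
  by move=> e; apply: (H j i) => //; rewrite eq_sym.
rewrite -words_rows; set s := mx_rows v.
have sz : size s = k by rewrite size_map size_enum_ord.
have js : (j < size s)%N by rewrite sz.
have it : (i < size (take j s))%N by rewrite size_takel ?(ltnW js).
rewrite -(cat_take_drop j s) (drop_nth 0 js).
rewrite -(cat_take_drop i (take j s)) (drop_nth 0 it) nth_take// !nth_mx_rows E -catA /=.
exact: antisym_repeat.
Qed.

Lemma words1E (f : 'M[R]_(1, n) -> R) u : words f [:: u] = f u.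
Proof.
by rewrite /words /=; congr f; apply/rowP => j; rewrite mxE.
Qed.

Lemma antisym_homog2 a : homog 2 a -> (forall x y, a [:: x; y] = - a [:: y; x]) ->
  antisym a.
Proof.
move=> ha aa [|z s] x y r; last by rewrite !ha ?oppr0//= !size_cat /= !addnS.
by case: r => [|z r]; [exact: aa|rewrite !ha ?oppr0].
Qed.

Lemma wlinear_homog2 a : homog 2 a -> antisym a ->
  (forall k x y z, a [:: k *: x + y; z] = k * a [:: x; z] + a [:: y; z]) -> wlinear a.
Proof.
move=> ha aa la [|z [|z' s]] k x y r; last first.
- by rewrite !ha ?mulr0 ?addr0//= !size_cat /= !addnS.
- case: r => [|z' r]; last by rewrite !ha ?mulr0 ?addr0.
  by rewrite /= ![a [:: z; _]](aa [::]) la; ring.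
by case: r => [|z [|z' r]]; rewrite ?la// !ha ?mulr0 ?addr0.
Qed.

Lemma mul_words11 a b u v : homog 1 a -> homog 1 b ->
  (a * b) [:: u; v] = a [:: u] * b [:: v] - a [:: v] * b [:: u].
Proof.
move=> ha hb; rewrite -[LHS]/(contract u (a * b) [:: v]) contract_wedge11//.
by rewrite wformDE wformNE !wformZE [b _ * a _]mulrC.
Qed.

Lemma mul_words21 a b u v z : homog 2 a -> homog 1 b ->
  (a * b) [:: u; v; z] =
  a [:: u; v] * b [:: z] - a [:: u; z] * b [:: v] + a [:: v; z] * b [:: u].
Proof.
move=> ha hb; rewrite -[LHS]/(contract u (a * b) [:: v; z]) contractM wformDE.
rewrite mul_words11//; last exact: homog_contract ha.
rewrite (contract_homog1 _ hb) wformZr mulr1 (homog_parity ha) scale1r wformZE.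
by rewrite /contract [b [:: u] * _]mulrC.
Qed.

End Pullback.

(** * Differential forms in charts *)

Section Forms.
Context {R : realType} {n : nat} {M : smoothManifold R n}.
Implicit Types (c : chart R n M) (p : M) (X : vfield M).
Local Notation V := 'rV[R]_n.
Local Notation wform := (@wform R V).

Lemma words_frep c k (a : kform M k) x :
  words (frep c a x) =
  pullback (mulmxr ('J (cto (chart_at (cinv c x)) \o cinv c) x)) (words (a (cinv c x))).
Proof. exact: words_pullback. Qed.

Lemma words_frep_cto c k (a : kform M k) p : cdom c p ->
  words (frep c a (cto c p)) =
  pullback (mulmxr (transition_mx c (chart_at p) p)) (words (a p)).
Proof. by move=> cp; rewrite words_frep ctoK. Qed.

Lemma words_frep_wedge c k l (a : kform M k) (b : kform M l) x :
  (forall p, antisym (words (a p))) -> (forall p, antisym (words (b p))) ->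
  words (frep c (wedge a b) x) = words (frep c a x) * words (frep c b x).
Proof.
by move=> aa ab; rewrite !words_frep words_wedge// pullbackM.
Qed.

Lemma words_frep_iprod c k X (a : kform M k.+1) p : atlas c -> cdom c p ->
  words (frep c (iprod X a) (cto c p)) =
  contract (vrep c X (cto c p)) (words (frep c a (cto c p))).
Proof.
move=> ac cp; have := vrepK X ac cp; rewrite !words_frep ctoK// words_iprod.
rewrite /transition_mx /transition => E.
by apply/funext => s; rewrite /contract /pullback /= E.
Qed.

Lemma wordsD k (f g : 'M[R]_(k, n) -> R) :
  words (fun v => f v + g v) = words f + words g.
Proof.
by apply/funext => s; rewrite wformDE /words; case: eqP => // _; rewrite addr0.
Qed.

Lemma wordsN k (f : 'M[R]_(k, n) -> R) : words (fun v => - f v) = - words f.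
Proof.
by apply/funext => s; rewrite wformNE /words; case: eqP => // _; rewrite oppr0.
Qed.

Lemma kform_eq k (a b : kform M k) : (forall p, words (a p) = words (b p)) -> a = b.
Proof. by move=> ab; apply/funext => p; apply/funext/words_inj. Qed.

Lemma is_zero_words k (a : kform M k) : is_zero a <-> forall p, words (a p) = 0.
Proof.
split=> [a0 p|a0 p v]; last by rewrite -words_rows a0.
by apply/funext => s; rewrite /words; case: eqP => // _; rewrite a0.
Qed.

Lemma form_wlinear k (a : kform M k) p : is_form a -> wlinear (words (a p)).
Proof. by case=> la _ _; apply: wlinear_words. Qed.

Lemma form_antisym k (a : kform M k) p : is_form a -> antisym (words (a p)).
Proof. by case=> la aa _; apply: antisym_words. Qed.

Lemma form_frep_wlinear k (a : kform M k) c x : is_form a -> wlinear (words (frep c a x)).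
Proof. by move=> fa; rewrite words_frep; apply/wlinear_pullback/form_wlinear. Qed.

Lemma form_frep_antisym k (a : kform M k) c x : is_form a -> antisym (words (frep c a x)).
Proof. by move=> fa; rewrite words_frep; apply/antisym_pullback/form_antisym. Qed.

Lemma form_smooth k (a : kform M k) c s : is_form a -> atlas c ->
  smooth_on (cimg c) (fun x => words (frep c a x) s).
Proof.
case=> _ _ sa ac; rewrite /words; case: eqP => _; last exact: smooth_on_cst.
exact: sa.
Qed.

(** Multilinearity and alternation are inherited by products and contractions of
    words, so checking them on words avoids manipulating matrices of rows. *)
Lemma is_form_words k (a : kform M k) :
  (forall p, wlinear (words (a p))) -> (forall p, antisym (words (a p))) ->
  (forall c, atlas c -> forall s, size s = k ->
     smooth_on (cimg c) (fun x => words (frep c a x) s)) ->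
  is_form a.
Proof.
move=> la aa sa; split=> [p|p|c ac v].
- exact: multilinear_words.
- exact: alternating_words.
have := sa c ac (mx_rows v); rewrite size_map size_enum_ord => /(_ erefl).
by apply: smooth_on_congr => [|x _]; [exact: cimg_open|rewrite words_rows].
Qed.

Lemma form1_antisym (a : kform M 1) p : antisym (words (a p)).
Proof. exact/antisym_homog1/homog_words. Qed.

Lemma form_differentiable c k (a : kform M k) p s : is_form a -> atlas c -> cdom c p ->
  differentiable (fun x => words (frep c a x) s) (cto c p).
Proof.
by move=> fa ac cp; apply: smooth_on_differentiable (form_smooth s fa ac) (cimg_cto cp).
Qed.

Lemma words_extd k (a : kform M k) p s : size s = k.+1 ->
  words (extd a p) s = \sum_(i < k.+1) (-1) ^+ i *
    'D_(nth 0 s i) (fun x => words (frep (chart_at p) a x) (take i s ++ drop i.+1 s))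
      (cto (chart_at p) p).
Proof.
move=> sk; rewrite {1}/words sk eqxx /extd; apply: eq_bigr => i _.
rewrite rowK; congr (_ * _).
have -> // : (fun x => frep (chart_at p) a x (row' i (mx_word k.+1 s))) =
  (fun x => words (frep (chart_at p) a x) (take i s ++ drop i.+1 s)).
apply/funext => x.
have si : (i < size s)%N by rewrite sk.
have ss : size (take i s ++ drop i.+1 s) = k.
  rewrite size_cat size_takel ?(ltnW si)// size_drop sk subSS subnKC//.
  by rewrite -ltnS.
rewrite /words ss eqxx; congr (frep _ a x _); apply/row_matrixP => j.
have -> : row j (row' i (mx_word k.+1 s)) = row (lift i j) (mx_word k.+1 s).
  by apply/rowP => l; rewrite !mxE.
rewrite !rowK nth_cat size_takel ?(ltnW si)//= /bump.
case: (ltnP j i) => ji.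
  by rewrite add0n nth_take.
by rewrite nth_drop addSn subnKC.
Qed.

Lemma words_extd1 (a : kform M 1) p u v :
  words (extd a p) [:: u; v] =
  'D_u (fun x => words (frep (chart_at p) a x) [:: v]) (cto (chart_at p) p) -
  'D_v (fun x => words (frep (chart_at p) a x) [:: u]) (cto (chart_at p) p).
Proof.
by rewrite words_extd// !big_ord_recl big_ord0 /= expr0 expr1 mul1r mulN1r addr0.
Qed.

Lemma words_extd2 (a : kform M 2) p u v z :
  words (extd a p) [:: u; v; z] =
  'D_u (fun x => words (frep (chart_at p) a x) [:: v; z]) (cto (chart_at p) p) -
  'D_v (fun x => words (frep (chart_at p) a x) [:: u; z]) (cto (chart_at p) p) +
  'D_z (fun x => words (frep (chart_at p) a x) [:: u; v]) (cto (chart_at p) p).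
Proof.
rewrite words_extd// !big_ord_recl big_ord0 /= expr0 expr1 mul1r mulN1r addr0.
by rewrite /bump /= add1n sqrrN expr1n mul1r addrA.
Qed.

Lemma words_lie2 X (w : kform M 2) p u v :
  let c := chart_at p in let x := cto c p in
  words (lie X w p) [:: u; v] =
  'D_(vrep c X x) (fun y => words (frep c w y) [:: u; v]) x +
  words (frep c w x) [:: 'D_u (vrep c X) x; v] +
  words (frep c w x) [:: u; 'D_v (vrep c X) x].
Proof.
move=> c x.
have s0 y : set_row ord0 y (mx_word 2 [:: u; v]) = mx_word 2 [:: y; v].
  by apply/row_matrixP => -[[|[|//]] i2]; rewrite !rowK /= ?rowK.
have s1 y : set_row (lift ord0 ord0) y (mx_word 2 [:: u; v]) = mx_word 2 [:: u; y].
  by apply/row_matrixP => -[[|[|//]] i2]; rewrite !rowK /= ?rowK.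
have r0 : row ord0 (mx_word 2 [:: u; v]) = u by rewrite rowK.
have r1 : row (lift ord0 ord0) (mx_word 2 [:: u; v]) = v by rewrite rowK.
rewrite -addrA -[LHS]/('D_(vrep c X x) (fun y => frep c w y (mx_word 2 [:: u; v])) x +
  \sum_(i < 2) frep c w x (set_row i ('D_(row i (mx_word 2 [:: u; v])) (vrep c X) x)
     (mx_word 2 [:: u; v]))).
have E (F : 'I_2 -> R) : \sum_(i < 2) F i = F ord0 + F (lift ord0 ord0).
  by rewrite !big_ord_recl big_ord0 addr0.
by rewrite E; congr (_ + _); rewrite /words /= r0 r1 s0 s1.
Qed.

End Forms.

(** * Naturality of the exterior derivative and smoothness of constructed objects *)

Section Naturality.
Context {R : realType} {n : nat} {M : smoothManifold R n}.
Implicit Types (c : chart R n M) (p : M) (X : vfield M).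
Local Notation V := 'rV[R]_n.
Local Notation wform := (@wform R V).

Lemma wlinear_expand (a : wform) v s : wlinear a ->
  a (v :: s) = \sum_j v 0 j * a (delta_mx 0 j :: s).
Proof.
move=> la; rewrite [in LHS](row_sum_delta v).
exact: (wlinear_sum [::] _ _ s la).
Qed.

Lemma derive_fsum (m k : nat) (f : 'I_m -> 'rV[R]_k -> R) x v :
  (forall j, differentiable (f j) x) ->
  'D_v (fun y => \sum_j f j y) x = \sum_j 'D_v (f j) x.
Proof.
move=> df; have -> : (fun y => \sum_j f j y) = \sum_(j < m) f j.
  by apply/funext => y; rewrite fct_sumE.
by apply: derive_sum => j; apply: diff_derivable.
Qed.

Lemma derive_fmul (k : nat) (f g : 'rV[R]_k -> R) x v :
  differentiable f x -> differentiable g x ->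
  'D_v (fun y => f y * g y) x = f x * 'D_v g x + g x * 'D_v f x.
Proof. by move=> df dg; apply: deriveM; apply: diff_derivable. Qed.

Lemma derive_fadd (k : nat) (f g : 'rV[R]_k -> R) x v :
  differentiable f x -> differentiable g x ->
  'D_v (fun y => f y + g y) x = 'D_v f x + 'D_v g x.
Proof. by move=> df dg; apply: deriveD; apply: diff_derivable. Qed.

Lemma derive_fsub (k : nat) (f g : 'rV[R]_k -> R) x v :
  differentiable f x -> differentiable g x ->
  'D_v (fun y => f y - g y) x = 'D_v f x - 'D_v g x.
Proof. by move=> df dg; apply: deriveB; apply: diff_derivable. Qed.

Lemma derive_fscale (k : nat) (e : R) (f : 'rV[R]_k -> R) x v :
  differentiable f x -> 'D_v (fun y => e * f y) x = e * 'D_v f x.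
Proof.
move=> df; have de : differentiable (fun=> e : R) x by exact: differentiable_cst.
by rewrite (derive_fmul v de df) derive_cst mulr0 addr0.
Qed.

Lemma differentiable_fmul (k : nat) (f g : 'rV[R]_k -> R) x :
  differentiable f x -> differentiable g x ->
  differentiable (fun y => f y * g y) x.
Proof. exact: differentiableM. Qed.

(** The product and chain rules applied to
    [a_c (y) v = \sum_j (D_v phi_j) y * a_c' (phi y) e_j].  The first sum, with
    second derivatives of the coordinate change, is symmetric in [u] and [v]. *)
Lemma derive_frep1_transition (a : kform M 1) c c' p u v :
  is_form a -> atlas c -> atlas c' -> cdom c p -> cdom c' p ->
  let phi j y := transition c c' y 0 j in
  let J := transition_mx c c' p in
  'D_u (fun y => words (frep c a y) [:: v]) (cto c p) =
  \sum_j words (frep c' a (cto c' p)) [:: delta_mx 0 j] *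
     'D_u ('D_v (phi j)) (cto c p) +
  'D_(u *m J) (fun y => words (frep c' a y) [:: v *m J]) (cto c' p).
Proof.
move=> fa ac ac' cp c'p phi J; set x := cto c p; set x' := cto c' p.
pose F j y := words (frep c' a y) [:: delta_mx 0 j].
have dF j : differentiable (F j) x' by apply: form_differentiable.
have Ux : overlap c c' x by exists p.
have sphi j : smooth_on (overlap c c') (phi j) by apply: transition_smooth.
have dphi : differentiable (transition c c') x by apply: transition_differentiable.
have tx : transition c c' x = x' by apply: transitionE.
have dF' j : differentiable (F j) (transition c c' x) by rewrite tx.
have dDphi j : differentiable ('D_v (phi j)) x.
  have H := smooth_on_derive v (overlap_open (c':=c')) (sphi j).
  exact: smooth_on_differentiable H Ux.
have dFphi j : differentiable (fun y => F j (transition c c' y)) x.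
  exact: differentiable_comp dphi (dF' j).
have vJ j : (v *m J) 0 j = 'D_v (phi j) x.
  rewrite /J /transition_mx (mul_jacobian v dphi).
  exact: derive_row.
have E1 : 'D_u (fun y => words (frep c a y) [:: v]) x =
    'D_u (fun y => \sum_j 'D_v (phi j) y * F j (transition c c' y)) x.
  apply: near_eq_derive; apply: filterS (near_overlap cp c'p) => y [q [cq c'q] <-].
  have dq := transition_differentiable ac ac' cq c'q.
  rewrite words1E (frep_transition a v ac ac' cq c'q) -words1E.
  rewrite wlinear_expand; last exact: form_frep_wlinear.
  apply: eq_bigr => j _; rewrite (transitionE c' cq); congr (_ * _).
  rewrite /transition_mx (mul_jacobian v dq).
  exact: derive_row.
have E2 : 'D_(u *m J) (fun y => words (frep c' a y) [:: v *m J]) x' =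
    \sum_j 'D_v (phi j) x * 'D_(u *m J) (F j) x'.
  have -> : (fun y => words (frep c' a y) [:: v *m J]) =
      (fun y => \sum_j (v *m J) 0 j * F j y).
    by apply/funext => y; rewrite wlinear_expand//; apply: form_frep_wlinear.
  have dv j : differentiable (fun=> (v *m J) 0 j) x' by exact: differentiable_cst.
  have dP j := differentiable_fmul (dv j) (dF j).
  apply: etrans (derive_fsum _ dP) _; apply: eq_bigr => j _.
  apply: etrans (derive_fmul _ (dv j) (dF j)) _.
  by rewrite derive_cst mulr0 addr0 vJ.
apply: (etrans E1); apply: etrans _ (congr1 (fun z => _ + z) (esym E2)).
have dP j := differentiable_fmul (dDphi j) (dFphi j).
apply: etrans (derive_fsum u dP) _; rewrite -big_split; apply: eq_bigr => j _ /=.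
apply: etrans (derive_fmul u (dDphi j) (dFphi j)) _; rewrite addrC.
have E3 : 'D_u (fun y => F j (transition c c' y)) x = 'D_(u *m J) (F j) x'.
  by apply: etrans (derive_comp u dphi (dF' j)) _; rewrite tx.
exact: congr2 (congr1 ( *%R ('D_v (phi j) x)) E3) (congr1 (fun z => F j z * _) tx).
Qed.

(** The exterior derivative is computed in the preferred chart of each point; any
    chart gives the same result, as the second derivatives of the change of
    coordinates cancel by symmetry.  Without this the values of [extd a] at
    neighbouring points could not be compared. *)
Lemma words_frep_extd1 (a : kform M 1) c p u v :
  is_form a -> atlas c -> cdom c p ->
  words (frep c (extd a) (cto c p)) [:: u; v] =
  'D_u (fun y => words (frep c a y) [:: v]) (cto c p) -
  'D_v (fun y => words (frep c a y) [:: u]) (cto c p).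
Proof.
move=> fa ac cp; set c' := chart_at p.
have ac' : atlas c' by apply: chart_at_atlas.
have c'p : cdom c' p by apply: chart_at_dom.
rewrite words_frep ctoK// -/c' /pullback /= words_extd1 -/c'.
have cancel_common (S1 S2 T1 T2 : R) : S1 = S2 -> T1 - T2 = (S1 + T1) - (S2 + T2).
  by move=> ->; rewrite opprD addrACA subrr add0r.
have E1 := derive_frep1_transition u v fa ac ac' cp c'p.
have E2 := derive_frep1_transition v u fa ac ac' cp c'p.
apply: etrans _ (esym (congr2 (fun y z => y - z) E1 E2)).
apply: cancel_common.
apply: eq_bigr => j _.
have Ux : overlap c c' (cto c p) by exists p.
have sj : smooth_on (overlap c c') (fun y => transition c c' y 0 j).
  exact: transition_smooth.
exact: congr1 (smooth_on_derive_comm v u (overlap_open (c':=c')) sj Ux).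
Qed.

Lemma near_cimg c p : cdom c p -> \forall y \near cto c p, exists2 q, cdom c q & y = cto c q.
Proof.
by move=> cp; apply: filterS (near_overlap cp cp) => y [q [cq _] <-]; exists q.
Qed.

Lemma is_form_extd1 (a : kform M 1) : is_form a -> is_form (extd a).
Proof.
move=> fa.
have lin p k x y z : words (extd a p) [:: k *: x + y; z] =
    k * words (extd a p) [:: x; z] + words (extd a p) [:: y; z].
  set c := chart_at p; set o := cto c p.
  have dA s : differentiable (fun x => words (frep c a x) s) o.
    by apply: form_differentiable => //; [exact: chart_at_atlas|exact: chart_at_dom].
  have dk : differentiable (fun=> k) o by exact: differentiable_cst.
  have E1 := derive_linear k x y (dA [:: z]).
  have E2 : 'D_z (fun y0 => words (frep c a y0) [:: k *: x + y]) o =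
      k * 'D_z (fun y0 => words (frep c a y0) [:: x]) o
      + 'D_z (fun y0 => words (frep c a y0) [:: y]) o.
    rewrite -(derive_fscale k z (dA [:: x])).
    rewrite -(derive_fadd z (differentiable_fmul dk (dA [:: x])) (dA [:: y])).
    congr derive; apply/funext => q; exact: (form_frep_wlinear c q fa [::]).
  have W1 := words_extd1 a p (k *: x + y) z.
  rewrite W1.
  apply: etrans (congr2 (fun r1 r2 => r1 - r2) E1 E2) _.
  apply: etrans _ (esym (congr2 (fun r1 r2 => k * r1 + r2) (words_extd1 a p x z)
    (words_extd1 a p y z))).
  have alg (a1 b1 a2 b2 : R) :
    (k * a1 + b1) - (k * a2 + b2) = k * (a1 - a2) + (b1 - b2) by ring.
  exact: alg.
have anti p : antisym (words (extd a p)).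
  apply: antisym_homog2; first exact: homog_words.
  by move=> x y; rewrite !words_extd1 opprB.
apply: is_form_words => // [p|c ac [|u [|v [|? ?]]]// _].
  by apply: wlinear_homog2 => //; exact: homog_words.
have oU : open (cimg c) by apply: cimg_open.
have H := smooth_onB oU (smooth_on_derive u oU (form_smooth [:: v] fa ac))
   (smooth_on_derive v oU (form_smooth [:: u] fa ac)).
apply: smooth_on_congr H => // x [p cp <-].
by rewrite words_frep_extd1.
Qed.

Lemma is_form_wedge11 (a b : kform M 1) : is_form a -> is_form b -> is_form (wedge a b).
Proof.
move=> fa fb; apply: is_form_words => [p|p|c ac [|u [|v [|? ?]]]// _].
- rewrite words_wedge; [|exact: form1_antisym|exact: form1_antisym].
  by apply: wlinearM; apply: form_wlinear.
- rewrite words_wedge; [|exact: form1_antisym|exact: form1_antisym].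
  by apply: antisymM; apply: form1_antisym.
have oU : open (cimg c) by apply: cimg_open.
have H := smooth_onB oU
  (smooth_onM oU (form_smooth [:: u] fa ac) (form_smooth [:: v] fb ac))
  (smooth_onM oU (form_smooth [:: v] fa ac) (form_smooth [:: u] fb ac)).
apply: smooth_on_congr H => // x _; rewrite words_frep_wedge;
  [|exact: form1_antisym|exact: form1_antisym].
by rewrite mul_words11//; apply: homog_words.
Qed.

Lemma is_formD k (a b : kform M k) : is_form a -> is_form b ->
  is_form (fun p v => a p v + b p v).
Proof.
move=> fa fb; apply: is_form_words => [p|p|c ac s _].
- by rewrite wordsD; apply: wlinearD; apply: form_wlinear.
- by rewrite wordsD; apply: antisymD; apply: form_antisym.
have oU : open (cimg c) by apply: cimg_open.
apply: smooth_on_congr (smooth_onD oU (form_smooth s fa ac) (form_smooth s fb ac)) => // x _.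
by rewrite -wformDE -wordsD.
Qed.

Lemma is_formN k (a : kform M k) : is_form a -> is_form (fun p v => - a p v).
Proof.
move=> fa; apply: is_form_words => [p|p|c ac s _].
- move=> s z x y r; rewrite wordsN !wformNE (form_wlinear p fa); ring.
- by move=> s x y r; rewrite wordsN !wformNE (form_antisym p fa).
have oU : open (cimg c) by apply: cimg_open.
apply: smooth_on_congr (smooth_onN oU (form_smooth s fa ac)) => // x _.
by rewrite -wformNE -wordsN.
Qed.

Lemma is_form_iprod k X (a : kform M k.+1) : is_form a -> is_vfield X ->
  is_form (iprod X a).
Proof.
move=> fa vX; apply: is_form_words => [p|p|c ac s _].
- by rewrite words_iprod; apply/wlinear_contract/form_wlinear.
- by rewrite words_iprod; apply/antisym_contract/form_antisym.
have oU : open (cimg c) by apply: cimg_open.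
have H : smooth_on (cimg c) (fun x => \sum_j vrep c X x 0 j *
    words (frep c a x) (delta_mx 0 j :: s)).
  apply: smooth_on_sum => // j; apply: smooth_onM => //; first exact: vX.
  exact: form_smooth.
apply: smooth_on_congr H => // x [p cp <-].
rewrite (words_frep_iprod X a ac cp) /contract -wlinear_expand//.
exact: form_frep_wlinear.
Qed.

(** In each chart the components of [X] solve a linear system whose matrix, the
    Gram matrix of [w], is invertible and smooth; Cramer's rule applies. *)
Lemma is_vfield_contraction (w : kform M 2) (b : kform M 1) X :
  is_form w -> is_form b -> (forall p, nondegenerate_word (words (w p))) ->
  iprod X w = b -> is_vfield X.
Proof.
move=> fw fb nw Xw c ac j.
have oU : open (cimg c) by apply: cimg_open.
have nwc x : cimg c x -> nondegenerate_word (words (frep c w x)).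
  move=> [p cp <-] u uw.
  have ap := chart_at_atlas p; have dp := chart_at_dom p.
  have J1 := transition_mxK ac ap cp dp; have J2 := transition_mxK ap ac dp cp.
  have u0 : u *m transition_mx c (chart_at p) p = 0.
    apply: (nw p); apply/funext => s; move: uw; rewrite (words_frep_cto w cp).
    set T := transition_mx c (chart_at p) p; set T' := transition_mx (chart_at p) c p.
    have sT : map (mulmxr T) (map (mulmxr T') s) = s.
      rewrite -map_comp (@eq_map _ _ _ id) ?map_id// => z.
      by rewrite -[LHS]/(z *m T' *m T) -mulmxA J2 mulmx1.
    move=> /(congr1 (@^~ (map (mulmxr T') s))) E.
    exact: etrans (congr1 (fun r => words (w p) (u *m T :: r)) (esym sT)) E.
  by rewrite -[u]mulmx1 -J1 mulmxA u0 mul0mx.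
have vX x : cimg c x -> vrep c X x = sharp (words (frep c w x)) (words (frep c b x)).
  move=> cx; have nx := nwc x cx.
  apply: (nondegenerate_contract_inj (form_frep_wlinear c x fw) nx).
  rewrite contract_sharp//; [|exact: homog_words|exact: form_frep_wlinear
    |exact: homog_words|exact: form_frep_wlinear].
  by case: cx nx => p cp <- _; rewrite -(words_frep_iprod X w ac cp) Xw.
have H : smooth_on (cimg c) (fun x => \sum_k
    words (frep c b x) [:: delta_mx 0 k] * invmx (gram (words (frep c w x))) k j).
  apply: smooth_on_sum => // k; apply: smooth_onM => //; first exact: form_smooth.
  apply: smooth_on_invmx => // [x cx|i l].
    apply: gram_unit; [exact: homog_words|exact: form_frep_wlinear|exact: nwc].
  apply: smooth_on_congr (form_smooth [:: delta_mx 0 i; delta_mx 0 l] fw ac) => // x _.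
  by rewrite mxE.
apply: smooth_on_congr H => // x cx; rewrite vX// /sharp mxE.
by apply: eq_bigr => k _; rewrite mxE.
Qed.

End Naturality.

(** * The form d alpha + alpha /\ beta and Cartan's formula *)

Section LcsCalculus.
Context {R : realType} {n : nat} {M : smoothManifold R n}.
Implicit Types (c : chart R n M) (p : M) (X : vfield M).
Local Notation V := 'rV[R]_n.
Local Notation wform := (@wform R V).

(** The product rule for [w_y (X_y, v)]. *)
Lemma derive_contraction (w : kform M 2) X c p u v :
  is_form w -> is_vfield X -> atlas c -> cdom c p ->
  'D_u (fun y => words (frep c (iprod X w) y) [:: v]) (cto c p) =
  'D_u (fun y => words (frep c w y) [:: vrep c X (cto c p); v]) (cto c p) +
  words (frep c w (cto c p)) [:: 'D_u (vrep c X) (cto c p); v].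
Proof.
move=> fw vX ac cp; set x := cto c p.
have cx : cimg c x by apply: cimg_cto.
pose xi j y := vrep c X y 0 j.
pose G j y := words (frep c w y) [:: delta_mx 0 j; v].
have dG j : differentiable (G j) x by apply: form_differentiable.
have dxi j : differentiable (xi j) x.
  exact: smooth_on_differentiable (vX c ac j) cx.
have dX : differentiable (vrep c X) x by apply: differentiable_row.
have dP j := differentiable_fmul (dxi j) (dG j).
have E1 : 'D_u (fun y => words (frep c (iprod X w) y) [:: v]) x =
    'D_u (fun y => \sum_j xi j y * G j y) x.
  apply: near_eq_derive; apply: filterS (near_cimg cp) => y [q cq ->].
  rewrite (words_frep_iprod X w ac cq) /contract.
  exact: (wlinear_expand _ _ (form_frep_wlinear c _ fw)).
have E2 : 'D_u (fun y => words (frep c w y) [:: vrep c X x; v]) x =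
    \sum_j xi j x * 'D_u (G j) x.
  have -> : (fun y => words (frep c w y) [:: vrep c X x; v]) =
      (fun y => \sum_j xi j x * G j y).
    by apply/funext => y; exact: (wlinear_expand _ _ (form_frep_wlinear c _ fw)).
  have dc j : differentiable (fun=> xi j x) x by exact: differentiable_cst.
  have dQ j := differentiable_fmul (dc j) (dG j).
  apply: etrans (derive_fsum u dQ) _; apply: eq_bigr => j _.
  exact: (derive_fscale (xi j x) u (dG j)).
have E3 : words (frep c w x) [:: 'D_u (vrep c X) x; v] =
    \sum_j G j x * 'D_u (xi j) x.
  apply: etrans (wlinear_expand _ _ (form_frep_wlinear c _ fw)) _.
  apply: eq_bigr => j _; rewrite mulrC; congr (_ * _).
  exact: derive_row.
apply: (etrans E1); apply: etrans _ (esym (congr2 +%R E2 E3)).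
apply: etrans (derive_fsum u dP) _; rewrite -big_split; apply: eq_bigr => j _.
exact: derive_fmul.
Qed.

(** Both sides are expanded in the preferred chart at [p]; the derivatives of the
    coefficients of [w] along [u] and [v] cancel. *)
Lemma cartan_formula (w : kform M 2) X p u v : is_form w -> is_vfield X ->
  words (lie X w p) [:: u; v] =
  words (extd (iprod X w) p) [:: u; v] + words (extd w p) [:: X p; u; v].
Proof.
move=> fw vX; set c := chart_at p; set x := cto c p.
have ac : atlas c by apply: chart_at_atlas.
have cp : cdom c p by apply: chart_at_dom.
have E1 := congr2 (fun r1 r2 => r1 - r2) (derive_contraction u v fw vX ac cp)
  (derive_contraction v u fw vX ac cp).
apply: etrans (words_lie2 X w p u v) _.
apply: etrans _ (esym (congr2 +%R (etrans (words_extd1 (iprod X w) p u v) E1)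
  (words_extd2 w p (X p) u v))).
have -> : X p = vrep c X x by rewrite chart_at_vrep.
have E2 : words (frep c w x) [:: u; 'D_v (vrep c X) x] =
  - words (frep c w x) [:: 'D_v (vrep c X) x; u].
  exact: (form_frep_antisym c x fw [::]).
apply: etrans (congr2 +%R erefl E2) _.
have alg (d1 d2 d3 g1 g2 : R) :
  d1 + g1 + - g2 = ((d2 + g1) - (d3 + g2)) + (d1 - d2 + d3) by ring.
exact: alg.
Qed.

(** The lcs form attached to a contact pair.  With this sign its Lee form is [b],
    because [d (d a + a /\ b) = d a /\ b = (d a + a /\ b) /\ b]. *)
Definition contact_lcs (a b : kform M 1) : kform M 2 :=
  fun p v => extd a p v + wedge a b p v.

Lemma words_contact_lcs (a b : kform M 1) p :
  words (contact_lcs a b p) = words (extd a p) + words (a p) * words (b p).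
Proof.
rewrite (wordsD (extd a p) (wedge a b p)); congr (_ + _).
exact: (words_wedge (form1_antisym a p) (form1_antisym b p)).
Qed.

Lemma is_form_contact_lcs (a b : kform M 1) : is_form a -> is_form b ->
  is_form (contact_lcs a b).
Proof.
by move=> fa fb; apply: is_formD; [exact: is_form_extd1|exact: is_form_wedge11].
Qed.

Lemma derive_contact_lcs (a b : kform M 1) c p u v z :
  is_form a -> is_form b -> atlas c -> cdom c p ->
  let A s y := words (frep c a y) [:: s] in
  let B s y := words (frep c b y) [:: s] in
  let x := cto c p in
  'D_u (fun y => words (frep c (contact_lcs a b) y) [:: v; z]) x =
  'D_u ('D_v (A z)) x - 'D_u ('D_z (A v)) x +
  (A v x * 'D_u (B z) x + B z x * 'D_u (A v) x) -
  (A z x * 'D_u (B v) x + B v x * 'D_u (A z) x).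
Proof.
move=> fa fb ac cp A B x.
have oU : open (cimg c) by apply: cimg_open.
have cx : cimg c x by apply: cimg_cto.
have dA s : differentiable (A s) x by apply: form_differentiable.
have dB s : differentiable (B s) x by apply: form_differentiable.
have dDA r s : differentiable ('D_r (A s)) x.
  have H := smooth_on_derive r oU (form_smooth [:: s] fa ac).
  exact: smooth_on_differentiable H cx.
have E1 : 'D_u (fun y => words (frep c (contact_lcs a b) y) [:: v; z]) x =
   'D_u (fun y => (('D_v (A z) y - 'D_z (A v) y) + A v y * B z y) - A z y * B v y) x.
  apply: near_eq_derive; apply: filterS (near_cimg cp) => y [q cq ->].
  rewrite (wordsD (frep c (extd a) (cto c q)) (frep c (wedge a b) (cto c q))) wformDE.
  have -> : words (frep c (wedge a b) (cto c q)) =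
      words (frep c a (cto c q)) * words (frep c b (cto c q)).
    by apply: words_frep_wedge; exact: form1_antisym.
  rewrite mul_words11; [|exact: homog_words|exact: homog_words].
  rewrite addrA; congr (_ + _ - _).
  exact: words_frep_extd1.
apply: (etrans E1).
have d1 : differentiable (fun y => 'D_v (A z) y - 'D_z (A v) y) x.
  by apply: differentiableB; exact: dDA.
have d2 := differentiable_fmul (dA v) (dB z).
have d3 := differentiable_fmul (dA z) (dB v).
have d12 : differentiable (fun y => ('D_v (A z) y - 'D_z (A v) y) + A v y * B z y) x.
  by apply: differentiableD; [exact: d1|exact: d2].
apply: etrans (derive_fsub u d12 d3) _.
apply: (congr2 (fun r1 r2 => r1 - r2)); last exact: derive_fmul.
apply: etrans (derive_fadd u d1 d2) _.
apply: (congr2 +%R); last exact: derive_fmul.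
exact: (derive_fsub u (dDA v z) (dDA z v)).
Qed.

(** In coordinates the second derivatives of [a] cancel (this is [d d = 0]), the
    first derivatives of [b] cancel as [b] is closed, and [a /\ b /\ b = 0]. *)
Lemma extd_contact_lcs (a b : kform M 1) : is_form a -> is_form b ->
  is_zero (extd b) -> extd (contact_lcs a b) = wedge (contact_lcs a b) b.
Proof.
move=> fa fb /is_zero_words db; apply: kform_eq => p.
have fw := is_form_contact_lcs fa fb.
apply: etrans _ (esym (words_wedge (form_antisym p fw) (form1_antisym b p))).
set c := chart_at p; set x := cto c p.
have ac : atlas c by apply: chart_at_atlas.
have cp : cdom c p by apply: chart_at_dom.
have oU : open (cimg c) by apply: cimg_open.
have cx : cimg c x by apply: cimg_cto.
pose A s y := words (frep c a y) [:: s].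
pose B s y := words (frep c b y) [:: s].
have SA r s t : 'D_r ('D_s (A t)) x = 'D_s ('D_r (A t)) x.
  exact: smooth_on_derive_comm oU (form_smooth [:: t] fa ac) cx.
have SB r s : 'D_r (B s) x = 'D_s (B r) x.
  have := congr1 (fun f : wform => f [:: r; s]) (db p).
  move=> /(etrans (esym (words_extd1 b p r s))) /eqP.
  by rewrite subr_eq0 => /eqP.
have Ax s : words (a p) [:: s] = A s x by rewrite /A /x chart_at_frep.
have Bx s : words (b p) [:: s] = B s x by rewrite /B /x chart_at_frep.
have dax r s : words (extd a p) [:: r; s] = 'D_r (A s) x - 'D_s (A r) x.
  exact: words_extd1.
have wx r s : words (contact_lcs a b p) [:: r; s] =
    ('D_r (A s) x - 'D_s (A r) x) + (A r x * B s x - A s x * B r x).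
  rewrite words_contact_lcs wformDE mul_words11; [|exact: homog_words|exact: homog_words].
  by rewrite !Ax !Bx; congr (_ + _); exact: dax.
have D r s t := derive_contact_lcs r s t fa fb ac cp.
apply/funext => s; have [s3|s3] := eqVneq (size s) 3%N; last first.
  rewrite [LHS]homog_words//.
  by rewrite (homogM (@homog_words _ _ 2 _) (@homog_words _ _ 1 _)).
case: s s3 => [|u [|v [|z [|? ?]]]]// _.
rewrite mul_words21; [|exact: homog_words|exact: homog_words].
apply: etrans (words_extd2 (contact_lcs a b) p u v z) _.
apply: etrans (congr2 (fun r1 r2 => r1 + r2) (congr2 (fun r1 r2 => r1 - r2)
  (D u v z) (D v u z)) (D z u v)) _.
apply: etrans _ (esym (congr2 (fun r1 r2 => r1 + r2) (congr2 (fun r1 r2 => r1 - r2)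
  (congr2 *%R (wx u v) (Bx z)) (congr2 *%R (wx u z) (Bx v)))
  (congr2 *%R (wx v z) (Bx u)))).
(* the cancellation as an identity between real numbers, with [ajk] for [D_j a_k],
   [b1 b2 b3] for the derivatives of [b], and [s1 s2 s3] for the second
   derivatives of [a] *)
have alg (s1 s1' s2 s2' s3 s3' au av az bu bv bz auv auz avu avz azu azv
    b1 b1' b2 b2' b3 b3' : R) :
  s1 = s1' -> s2 = s2' -> s3 = s3' -> b1 = b1' -> b2 = b2' -> b3 = b3' ->
  (s1 - s2 + (av * b1 + bz * auv) - (az * b2 + bv * auz)) -
  (s1' - s3 + (au * b3 + bz * avu) - (az * b2' + bu * avz)) +
  (s2' - s3' + (au * b3' + bv * azu) - (av * b1' + bu * azv)) =
  ((auv - avu) + (au * bv - av * bu)) * bz -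
  ((auz - azu) + (au * bz - az * bu)) * bv +
  ((avz - azv) + (av * bz - az * bv)) * bu.
  by move=> -> -> -> -> -> ->; ring.
apply: alg; [exact: SA|exact: SA|exact: SA|exact: SB|exact: SB|exact: SB].
Qed.

Lemma words_extdN1 (a : kform M 1) p : is_form a ->
  words (extd (fun q v => - a q v) p) = - words (extd a p).
Proof.
move=> fa; set c := chart_at p; set x := cto c p.
have ac : atlas c by apply: chart_at_atlas.
have cp : cdom c p by apply: chart_at_dom.
apply/funext => s; rewrite wformNE; have [s2|s2] := eqVneq (size s) 2%N; last first.
  by rewrite !homog_words ?oppr0.
case: s s2 => [|u [|v [|? ?]]]// _.
have N r t : 'D_r (fun y => words (frep c (fun q v => - a q v) y) [:: t]) x =
    - 'D_r (fun y => words (frep c a y) [:: t]) x.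
  have da : differentiable (fun y => words (frep c a y) [:: t]) x.
    by apply: form_differentiable.
  rewrite -[RHS]mulN1r -(derive_fscale (-1) r da); congr derive.
  by apply/funext => y; rewrite mulN1r -wformNE -wordsN.
apply: etrans (words_extd1 _ p u v) _.
apply: etrans (congr2 (fun r1 r2 => r1 - r2) (N u v) (N v u)) _.
apply: etrans _ (esym (congr1 -%R (words_extd1 a p u v))).
by rewrite opprB opprK addrC.
Qed.

End LcsCalculus.

(** * The correspondence between contact pairs and lcs forms *)

Section Correspondence.
Context {R : realType} {n : nat} {M : smoothManifold R n}.
Implicit Types (p : M) (X : vfield M).
Local Notation V := 'rV[R]_n.
Local Notation wform := (@wform R V).

Lemma words2E (f : 'M[R]_(2, n) -> R) (u v : V) : words f [:: u; v] = f (col_mx u v).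
Proof.
rewrite /words /=; congr f; apply/row_matrixP => i; rewrite rowK.
case: (unliftP ord0 i) => [j|] ->.
  have -> : lift ord0 j = rshift 1 (ord0 : 'I_1) by apply: val_inj; rewrite (ord1 j).
  transitivity (row ord0 v); first by apply/rowP => k; rewrite !mxE.
  by rewrite -[RHS]/(row (rshift 1 (ord0 : 'I_1)) (col_mx u v)) rowKd.
have -> : ord0 = lshift 1 (ord0 : 'I_1) by apply: val_inj.
transitivity (row ord0 u); first by apply/rowP => k; rewrite !mxE.
by rewrite -[RHS]/(row (lshift 1 (ord0 : 'I_1)) (col_mx u v)) rowKu.
Qed.

Lemma nondegenerateP (w : kform M 2) :
  Defs.nondegenerate w <-> forall p, nondegenerate_word (words (w p)).
Proof.
split=> nw p u uw; apply: (nw p).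
  by move=> v; rewrite -words2E -[LHS]/(contract u (words (w p)) [:: v]) uw.
apply: (@homog_eq0 _ _ 1 _ (homog_contract u (@homog_words _ _ 2 (w p)))).
by move=> -[|v [|? ?]]// _; rewrite /contract words2E uw.
Qed.

(** The field [L] with [i_L w = b]; it turns out to be the Reeb field [A]. *)
Definition reebA (a b : kform M 1) : vfield M :=
  fun p => sharp (words (contact_lcs a b p)) (words (b p)).
(** The field [X] with [i_X w = - a]; it turns out to be the Reeb field [B]. *)
Definition reebB (a b : kform M 1) : vfield M :=
  fun p => sharp (words (contact_lcs a b p)) (- words (a p)).

Definition opp_form k (a : kform M k) : kform M k := fun p v => - a p v.

(** Two Lee forms have the same product with [w], so [nondegenerate_mul_eq0]
    applies to their difference. *)
Lemma lee_form_unique (w : kform M 2) (t t' : kform M 1) : (2 < n)%N ->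
  lcs_with_Lee_form w t -> lcs_with_Lee_form w t' -> t = t'.
Proof.
move=> n2 [fw /nondegenerateP nw ft _ dt] [_ _ ft' _ dt'].
apply: kform_eq => p.
have aw := form_antisym p fw; have lw := form_wlinear p fw.
have E : words (w p) * words (t p) = words (w p) * words (t' p).
  have E1 := words_wedge aw (form1_antisym t p).
  have E2 := words_wedge aw (form1_antisym t' p).
  by rewrite -E1 -E2 -dt -dt'.
apply/eqP; rewrite -subr_eq0; apply/eqP.
have ht := @homog_words R n 1 (t p); have ht' := @homog_words R n 1 (t' p).
apply: (nondegenerate_mul_eq0 n2 _ lw (nw p)).
- exact: homog_words.
- by rewrite -scaleN1r; apply: homogD => //; apply: homogZ.
- rewrite -wordsN -wordsD; have := wlinearD (form_wlinear p ft)
    (form_wlinear p (is_formN ft')).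
  by rewrite wordsD wordsN.
by rewrite mulrBr E subrr.
Qed.

Lemma ev1E (a : kform M 1) X p : ev1 a X p = words (a p) [:: X p].
Proof. by rewrite words1E. Qed.

(** Cartan's formula with [d w = w /\ t] and [t X = 1].  For [a = - i_X w] it reads
    [L_X w = - d a - a /\ t + w], so [X] preserves [w] exactly when
    [w = d a + a /\ t]. *)
Lemma lie_of_lcs (w : kform M 2) (t : kform M 1) X p : is_form w -> is_vfield X ->
  extd w = wedge w t -> ev1 t X p = 1 ->
  words (lie X w p) = words (extd (iprod X w) p) +
    (contract (X p) (words (w p)) * words (t p) + words (w p)).
Proof.
move=> fw vX dw tX.
have hw := @homog_words R n 2 (w p); have ht := @homog_words R n 1 (t p).
have E : contract (X p) (words (extd w p)) =
    contract (X p) (words (w p)) * words (t p) + words (w p).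
  have E1 := words_wedge (form_antisym p fw) (form1_antisym t p).
  have E2 : words (extd w p) = words (w p) * words (t p) by rewrite -E1 dw.
  rewrite E2 contractM (contract_homog1 _ ht) -ev1E tX scale1r mulr1.
  by rewrite (homog_parity hw) scale1r.
apply/funext => s; rewrite wformDE.
have [s2|s2] := eqVneq (size s) 2%N; last first.
  rewrite homog_words// homog_words//.
  rewrite -[X in _ = _ + X]/((_ : wform) s) -E /contract homog_words ?addr0//.
case: s s2 => [|u [|v [|? ?]]]// _.
rewrite -E; exact: cartan_formula.
Qed.

End Correspondence.

Section ContactLcs.
Context {R : realType} {h : nat} {M : smoothManifold R h.*2.+2}.
Implicit Types (p : M) (X : vfield M).
Local Notation n := h.*2.+2.

Lemma words_contact_volume (a b : kform M 1) p : is_form a ->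
  words (contact_volume a b p) =
  words (a p) * words (extd a p) ^+ h * words (b p).
Proof.
move=> fa; have ae := form_antisym p (is_form_extd1 fa).
have E1 := words_wedge_pow h ae.
have ap : antisym (words (wedge_pow (extd a) h p)) by rewrite E1; apply: antisymX.
have E2 := words_wedge (form1_antisym a p) ap.
have a2 : antisym (words (wedge a (wedge_pow (extd a) h) p)).
  by rewrite E2; apply: antisymM => //; exact: form1_antisym.
have E3 := words_wedge a2 (form1_antisym b p).
rewrite -E1 -E2 -E3; exact: words_cast.
Qed.

Lemma contact_pair_algebra (a b : kform M 1) p : contact_pairs M (a, b) ->
  let w := words (contact_lcs a b p) in
  let A := reebA a b p in let B := reebB a b p in
  [/\ nondegenerate_word w,
      contract A (words (extd a p)) = 0 /\ contract B (words (extd a p)) = 0,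
      words (a p) [:: A] = 1 /\ words (a p) [:: B] = 0 &
      words (b p) [:: A] = 0 /\ words (b p) [:: B] = 1].
Proof.
move=> [/= fa fb vol pow _].
have fe := is_form_extd1 fa.
rewrite /reebA /reebB words_contact_lcs.
apply: (@contact_algebra _ _ h) => //; do ?[exact: homog_words].
- exact: form_antisym.
- exact: form_wlinear.
- exact: form_wlinear.
- exact: form_wlinear.
- rewrite -(words_wedge_pow h.+1 (form_antisym p fe)).
  by apply/is_zero_words: p.
rewrite -(words_contact_volume b p fa) => v0.
by have [v /eqP] := vol p; rewrite -words_rows v0.
Qed.

End ContactLcs.

Section Bijection.
Context {R : realType} {h : nat} {M : smoothManifold R h.*2.+2}.
Implicit Types (p : M) (X : vfield M).
Local Notation n := h.*2.+2.

Lemma iprod_reebAB (a b : kform M 1) : contact_pairs M (a, b) ->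
  iprod (reebA a b) (contact_lcs a b) = b /\
  iprod (reebB a b) (contact_lcs a b) = opp_form a.
Proof.
move=> ab; have [/= fa fb _ _ _] := ab.
have fw := is_form_contact_lcs fa fb.
split; apply: kform_eq => p; rewrite words_iprod;
  have [nw _ _ _] := contact_pair_algebra p ab.
  apply: contract_sharp => //; do ?[exact: homog_words].
    exact: form_wlinear.
  exact: form_wlinear.
rewrite /opp_form wordsN; apply: contract_sharp => //.
- exact: homog_words.
- exact: form_wlinear.
- by rewrite -scaleN1r; apply/homogZ/homog_words.
by have := form_wlinear p (is_formN fa); rewrite wordsN.
Qed.

Lemma is_vfield_reebAB (a b : kform M 1) : contact_pairs M (a, b) ->
  is_vfield (reebA a b) /\ is_vfield (reebB a b).
Proof.
move=> ab; have [/= fa fb _ _ _] := ab; have [iL iB] := iprod_reebAB ab.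
have fw := is_form_contact_lcs fa fb.
have nw p : nondegenerate_word (words (contact_lcs a b p)).
  by have [] := contact_pair_algebra p ab.
split; [exact: is_vfield_contraction fw fb nw iL|].
exact: is_vfield_contraction fw (is_formN fa) nw iB.
Qed.

Lemma contact_pair_lcs (a b : kform M 1) : contact_pairs M (a, b) ->
  lcs_with_Lee_form (contact_lcs a b) b.
Proof.
move=> ab; have [/= fa fb _ _ db] := ab; split => //.
- exact: is_form_contact_lcs.
- by apply/nondegenerateP => p; have [] := contact_pair_algebra p ab.
- exact: extd_contact_lcs.
Qed.

Lemma lee_form_reebB (a b : kform M 1) p : contact_pairs M (a, b) ->
  ev1 b (reebB a b) p = 1.
Proof. by move=> ab; rewrite ev1E; have [_ _ _ []] := contact_pair_algebra p ab. Qed.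

Lemma contact_pair_lie (a b : kform M 1) : contact_pairs M (a, b) ->
  is_zero (lie (reebB a b) (contact_lcs a b)).
Proof.
move=> ab; have [/= fa fb _ _ db] := ab; apply/is_zero_words => p.
have fw := is_form_contact_lcs fa fb.
have [_ vB] := is_vfield_reebAB ab; have [_ iB] := iprod_reebAB ab.
have dw := extd_contact_lcs fa fb db.
rewrite (lie_of_lcs fw vB dw (lee_form_reebB p ab)).
rewrite -words_iprod iB words_extdN1// /opp_form wordsN words_contact_lcs.
by rewrite mulNr (addrC (words (extd a p))) addKr addNr.
Qed.

(** The Reeb equations say that the contractions of [w] with [A] and [B] are [b]
    and [- a], and these determine the fields because [w] is non-degenerate. *)
Lemma contact_pair_reebE (a b : kform M 1) A B : contact_pairs M (a, b) ->
  is_reeb_pair a b A B <-> A = reebA a b /\ B = reebB a b.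
Proof.
move=> ab; have [/= fa fb _ _ db] := ab.
have fw := is_form_contact_lcs fa fb.
have [vL vB] := is_vfield_reebAB ab; have [iL iB] := iprod_reebAB ab.
split=> [[vA' vB' AB [Aa _] [Ba _]]|[-> ->]].
  have W X p : is_zero (iprod X (extd a)) ->
      contract (X p) (words (contact_lcs a b p)) =
      ev1 a X p *: words (b p) - ev1 b X p *: words (a p).
    move=> /is_zero_words /(_ p); rewrite words_iprod => Xe.
    rewrite words_contact_lcs contractD Xe add0r contract_wedge11 ?ev1E//;
      exact: homog_words.
  have inj X Y : (forall p, contract (X p) (words (contact_lcs a b p)) =
      contract (Y p) (words (contact_lcs a b p))) -> X = Y.
    move=> XY; apply/funext => p; have [nw _ _ _] := contact_pair_algebra p ab.
    by apply: nondegenerate_contract_inj nw (XY p); apply: form_wlinear.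
  split; apply: inj => p; have [a1 b1 a0 b0] := AB p; rewrite W//.
    by rewrite a1 b0 scale1r scale0r subr0 -words_iprod iL.
  by rewrite b1 a0 scale1r scale0r add0r -words_iprod iB /opp_form wordsN.
have db0 p : words (extd b p) = 0 by apply/is_zero_words: p.
split=> //.
- move=> p; rewrite !ev1E.
  by have [_ _ [aL aB] [bL bB]] := contact_pair_algebra p ab.
- split; apply/is_zero_words => p; rewrite words_iprod.
    by have [_ []] := contact_pair_algebra p ab.
  by rewrite db0.
- split; apply/is_zero_words => p; rewrite words_iprod.
    by have [_ []] := contact_pair_algebra p ab.
  by rewrite db0.
Qed.

Lemma contact_pair_orientation (a b : kform M 1) : contact_pairs M (a, b) ->
  same_orientation (wedge_pow (contact_lcs a b) h.+1) (contact_volume a b).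
Proof.
move=> ab; have [/= fa fb vol pow db] := ab.
have fw := is_form_contact_lcs fa fb; have fe := is_form_extd1 fa.
have E p v : wedge_pow (contact_lcs a b) h.+1 p v =
    h.+1%:R * contact_volume a b p v.
  have E1 : words (extd a p) ^+ h.+1 = 0.
    rewrite -(words_wedge_pow h.+1 (form_antisym p fe)).
    by apply/is_zero_words: p.
  have E2 : words (wedge_pow (contact_lcs a b) h.+1 p) =
      h.+1%:R *: words (contact_volume a b p).
    rewrite (words_wedge_pow h.+1 (form_antisym p fw)) words_contact_volume//.
    rewrite words_contact_lcs exp_plus_product ?E1 ?add0r//; exact: homog_words.
  rewrite -words_rows; apply: etrans (congr1 (@^~ (mx_rows v)) E2) _.
  by rewrite wformZE words_rows.
have h0 : (0 : R) < h.+1%:R by rewrite ltr0n.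
split=> // [p|p v].
  have [v v0] := vol p; exists v.
  by apply: (eq_ind_r (fun z => z != 0) _ (E p v)); rewrite mulf_neq0// gt_eqF.
by apply: etrans (congr1 (fun z => 0 < z) (E p v)) _; rewrite pmulr_rgt0.
Qed.

(** The vanishing of the Lie derivative, rewritten by Cartan's formula. *)
Lemma lcs_contact_form (w : kform M 2) (t : kform M 1) X :
  lcs_with_Lee_form w t -> is_vfield X -> is_zero (lie X w) ->
  (forall p, ev1 t X p = 1) ->
  contact_lcs (opp_form (iprod X w)) t = w.
Proof.
move=> [fw nw ft dt dw] vX lX tX; apply: kform_eq => p.
have fi := is_form_iprod fw vX.
rewrite words_contact_lcs words_extdN1// /opp_form wordsN mulNr -opprD.
have := lie_of_lcs fw vX dw (tX p); have /is_zero_words -> := lX.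
rewrite addrA -words_iprod => /eqP.
by rewrite eq_sym addrC addr_eq0 => /eqP/esym.
Qed.

Lemma lcs_contact_pair (w : kform M 2) (t : kform M 1) X :
  lcs_with_Lee_form w t -> is_vfield X -> is_zero (lie X w) ->
  (forall p, ev1 t X p = 1) ->
  contact_pairs M (opp_form (iprod X w), t).
Proof.
move=> lw vX lX tX; have Ew := lcs_contact_form lw vX lX tX.
move: lw => [fw /nondegenerateP nw ft dt dw].
set a := opp_form (iprod X w).
have fa : is_form a by apply/is_formN/is_form_iprod.
have fe := is_form_extd1 fa.
have aE p : words (a p) = - contract (X p) (words (w p)).
  by rewrite -words_iprod -wordsN.
have eE p : words (extd a p) = words (w p) - words (a p) * words (t p).
  by rewrite -[in RHS]Ew words_contact_lcs addrK.
have alg p : words (extd a p) ^+ h.+1 = 0 /\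
    words (a p) * words (extd a p) ^+ h * words (t p) <> 0.
  rewrite eE aE; apply: lcs_algebra => //; do ?[exact: homog_words].
  - exact: form_antisym.
  - exact: form_wlinear.
  - exact: form_wlinear.
  - by rewrite -ev1E.
split=> //=.
- move=> p; apply: contrapT => v0; have [_] := alg p; apply.
  rewrite -words_contact_volume//; apply/funext => s; rewrite /words.
  case: eqP => // _; apply/eqP/negPn/negP => vs; apply: v0.
  by exists (mx_word h.*2.+2 s).
apply/is_zero_words => p.
by apply: etrans (words_wedge_pow h.+1 (form_antisym p fe)) _; have [] := alg p.
Qed.

Lemma lcs_reebB (w : kform M 2) (t : kform M 1) X :
  lcs_with_Lee_form w t -> is_vfield X -> is_zero (lie X w) ->
  (forall p, ev1 t X p = 1) ->
  reebB (opp_form (iprod X w)) t = X.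
Proof.
move=> lw vX lX tX; have Ew := lcs_contact_form lw vX lX tX.
have [_] := iprod_reebAB (lcs_contact_pair lw vX lX tX); rewrite Ew => iB.
move: lw => [fw /nondegenerateP nw ft dt dw].
apply/funext => p; apply: nondegenerate_contract_inj (form_wlinear p fw) (nw p) _.
by rewrite -!words_iprod iB; congr words; apply/funext => v; apply: opprK.
Qed.

End Bijection.

Theorem proposition3p1 (R : realType) (h : nat) (hpos : (0 < h)%N)
    (M : smoothManifold R h.*2.+2) :
  exists F : kform M 1 * kform M 1 -> kform M 2 * vfield M,
    set_bij (contact_pairs M) (lcs_structures M) F /\
    forall (a b : kform M 1) (w : kform M 2) (X : vfield M),
      contact_pairs M (a, b) -> F (a, b) = (w, X) ->
      exists (t : kform M 1) (L : vfield M),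
        [/\ forall t', lcs_with_Lee_form w t' <-> t' = t,
            forall Y, (is_vfield Y /\ iprod Y w = t) <-> Y = L,
            forall A B, is_reeb_pair a b A B <-> A = L /\ B = X &
            same_orientation (wedge_pow w h.+1) (contact_volume a b)].
Proof.
have n2 : (2 < h.*2.+2)%N by rewrite !ltnS double_gt0.
exists (fun ab => (contact_lcs ab.1 ab.2, reebB ab.1 ab.2)); split.
  split=> [[a b] ab|[a b] [a' b'] /set_mem ab /set_mem ab' [Ew EB]|[w X] [t [lw vX lX tX]]].
  - exists b; split; first exact: contact_pair_lcs.
    + by have [] := is_vfield_reebAB ab.
    + exact: contact_pair_lie.
    + by move=> p; apply: lee_form_reebB.
  - have Eb : b = b'.
      apply: (lee_form_unique n2 (contact_pair_lcs ab)).
      by rewrite /= in Ew; rewrite Ew; apply: contact_pair_lcs.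
    congr (_, _) => //; have [_ iB] := iprod_reebAB ab; have [_ iB'] := iprod_reebAB ab'.
    have : opp_form a = opp_form a' by rewrite -iB -iB' /= in Ew EB *; rewrite Ew EB.
    move=> E; apply/funext => p; apply/funext => v; apply: oppr_inj.
    by rewrite -[LHS]/(opp_form a p v) E.
  - exists (opp_form (iprod X w), t); first exact: lcs_contact_pair.
    by rewrite /= (lcs_contact_form lw vX lX tX) (lcs_reebB lw vX lX tX).
move=> a b _ _ ab [<- <-]; exists b, (reebA a b).
have [vL _] := is_vfield_reebAB ab; have [iL _] := iprod_reebAB ab.
split.
- move=> t'; split=> [lt|->]; last exact: contact_pair_lcs.
  exact: lee_form_unique n2 lt (contact_pair_lcs ab).
- move=> Y; split=> [[vY iY]|-> //]; apply/funext => p.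
  have [nw _ _ _] := contact_pair_algebra p ab; have [/= fa fb _ _ _] := ab.
  apply: nondegenerate_contract_inj (form_wlinear p (is_form_contact_lcs fa fb)) nw _.
  by rewrite -!words_iprod iY iL.
- by move=> A B; apply: contact_pair_reebE.
exact: contact_pair_orientation.
Qed.
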